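(* Let $p$ be a nonconstant polynomial hyperbolic in direction $e$, where $Ae=b$, and let $q_e:=p/p'_e$ on $\Lambda'_{++,e}$. Then the optimal solutions of HP that lie in $\Lambda'_{++,e}$ are exactly the optimal solutions of the convex optimization problem $$\min_{x\in\Lambda'_{++,e}}\ -\ln c^*(e-x)-q_e(x)\quad\text{s.t. } Ax=b$$ (where the domain is restricted to those $x$ with $c^*(e-x)>0$, so that the objective is defined). Both sets may be empty.
   Context: $\mathcal{E}$ is a finite-dimensional Euclidean space. A homogeneous polynomial $p:\mathcal{E}\to\mathbb{R}$ is hyperbolic in direction $e\in\mathcal{E}$ if $p(e)>0$ and for every $x\in\mathcal{E}$ the polynomial $t\mapsto p(x+te)$ has only real roots. $\Lambda_{++}$ is the connected component of $\{p>0\}$ containing $e$, and $\Lambda_+$ is its closure (a closed convex cone, not assumed to be regular here). $p'_e(x):=Dp(x)[e]$ is hyperbolic in direction $e$ and $\Lambda'_{++,e}$ is the connected component of $\{p'_e>0\}$ containing $e$ (equal to $\mathcal{E}$ if $p$ is linear). $A:\mathcal{E}\to\mathbb{R}^m$ is linear and surjective, $0\ne b\in\mathbb{R}^m$, and $c^*$ is a linear functional on $\mathcal{E}$ not in the image of $A^*$ (i.e. not of the form $y^*A$). HP is the problem of minimizing $c^*x$ subject to $Ax=b$, $x\in\Lambda_+$. *)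

(* Defs.v *)
(* The notations of mpoly clash with those of MathComp-Analysis. *)
From HB Require Import structures.
From mathcomp Require Import all_boot all_order all_algebra.
From mathcomp Require Import -(notations) complex mpoly.
From mathcomp Require Import all_classical all_reals all_analysis.

Set Implicit Arguments.
Unset Strict Implicit.
Unset Printing Implicit Defensive.

Import Order.TTheory GRing.Theory Num.Theory.
Import numFieldNormedType.Exports.

Local Open Scope classical_set_scope.
Local Open Scope ring_scope.

Definition nonconstant (R : realType) (n : nat) (p : mpoly n R) : Prop :=
  forall a : R, p <> mpolyC n a.

Definition homogeneous (R : realType) (n : nat) (p : mpoly n R) : Prop :=
  exists d : nat,
    p \is ishomog1 d (@mdeg n).

Definition peval (R : realType) (n : nat) (p : mpoly n R)
    (x : 'cV[R]_n) : R :=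
  meval (fun i => x i ord0) p.

(* The univariate polynomial t |-> p (x + t e). *)
Definition line_poly (R : realType) (n : nat) (p : mpoly n R)
    (x e : 'cV[R]_n) : {poly R} :=
  mmap (@polyC R) (fun i => (x i ord0)%:P + e i ord0 *: 'X) p.

Definition real_rooted (R : realType) (u : {poly R}) : Prop :=
  forall z : complex R,
    root (map_poly (@real_complex_def R (Phant R)) u) z ->
    complex.Im z = 0.

Definition hyperbolic (R : realType) (n : nat) (p : mpoly n R)
    (e : 'cV[R]_n) : Prop :=
  [/\ homogeneous p, 0 < peval p e & forall x, real_rooted (line_poly p x e)].

(* The function p'_e : x |-> Dp(x)[e], with D the Frechet derivative. *)
Definition dirderiv (R : realType) (n : nat) (p : mpoly n R)
    (e x : 'cV[R]_n) : R :=
  'd (peval p) x e.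

(* The connected component of {f > 0} containing e (empty unless f e > 0). *)
Definition pos_component (R : realType) (n : nat) (f : 'cV[R]_n -> R)
    (e : 'cV[R]_n) : set 'cV[R]_n :=
  connected_component [set x | 0 < f x] e.

(* The cone Lambda_+. *)
Definition hyp_cone (R : realType) (n : nat) (p : mpoly n R)
    (e : 'cV[R]_n) : set 'cV[R]_n :=
  closure (pos_component (peval p) e).

(* The open cone Lambda'_{++,e}. *)
Definition deriv_open_cone (R : realType) (n : nat) (p : mpoly n R)
    (e : 'cV[R]_n) : set 'cV[R]_n :=
  pos_component (dirderiv p e) e.

(* Only meaningful on Lambda'_{++,e}, where the denominator is positive. *)
Definition qfun (R : realType) (n : nat) (p : mpoly n R)
    (e x : 'cV[R]_n) : R :=
  peval p x / dirderiv p e x.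

(* Linear functionals are row vectors: c^* x is the 1 x 1 product c *m x. *)
Definition app (R : realType) (n : nat) (c : 'rV[R]_n) (x : 'cV[R]_n) : R :=
  (c *m x) ord0 ord0.

Definition minimizers (R : realType) (T : Type) (S : set T) (f : T -> R) :
    set T :=
  [set x | S x /\ forall y, S y -> f x <= f y].

Definition convex_program (R : realType) (n : nat) (S : set 'cV[R]_n)
    (f : 'cV[R]_n -> R) : Prop :=
  @convex_set R 'cV[R]_n S /\ @convex_function R 'cV[R]_n S f.

Definition HP_feasible (R : realType) (m n : nat) (A : 'M[R]_(m, n))
    (b : 'cV[R]_m) (p : mpoly n R) (e : 'cV[R]_n) : set 'cV[R]_n :=
  [set x | A *m x = b /\ hyp_cone p e x].

Definition HP_optimal (R : realType) (m n : nat) (A : 'M[R]_(m, n))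
    (b : 'cV[R]_m) (c : 'rV[R]_n) (p : mpoly n R) (e : 'cV[R]_n) :
    set 'cV[R]_n :=
  minimizers (HP_feasible A b p e) (app c).

Definition log_domain (R : realType) (m n : nat) (A : 'M[R]_(m, n))
    (b : 'cV[R]_m) (c : 'rV[R]_n) (p : mpoly n R) (e : 'cV[R]_n) :
    set 'cV[R]_n :=
  [set x | [/\ deriv_open_cone p e x, A *m x = b & 0 < app c (e - x)]].

Definition log_objective (R : realType) (n : nat) (c : 'rV[R]_n)
    (p : mpoly n R) (e x : 'cV[R]_n) : R :=
  - ln (app c (e - x)) - qfun p e x.

(* Main.v *)
(** Write [C(p, e)] for the set of [y] with [p (y + t e) > 0] for all [t >= 0];
    for a hyperbolic [p] it is the component of [{p > 0}] containing [e], and by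
    Garding's theorem [p] is hyperbolic in every direction of [C(p, e)], which
    makes this cone convex.  Since [u - s u'] is real-rooted whenever [u] is,
    the polynomial [p(x) - s p'_e(x)] in the variables [(s, x)] is hyperbolic in
    direction [(0, e)], and by Laguerre's inequality [u u'' <= u'^2] its cone
    contains the strict hypograph of [q_e = p / p'_e] over [C(p'_e, e)]:
    convexity of the cone is concavity of [q_e].

    If [x] minimizes the logarithmic objective, stationarity along [x - e] reads
    [p(x) (p'_e(x) + p''_e(x)) = 0] by Euler's identity, so [p(x) = 0].  If [x]
    is optimal for HP, then [p(x) = 0] as well, for otherwise [x] would be an
    interior point.  At a zero of [p] the derivative of [q_e] is [Dp(x) / p'_e(x)],
    and both problems have the same optimality condition on [ker A],
    [c(v) p'_e(x) = c(e - x) Dp(x)[v]]. *)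
Require Import Defs.
From HB Require Import structures.
From mathcomp Require Import all_boot all_order all_algebra.
From mathcomp Require Import -(notations) complex mpoly.
From mathcomp Require Import all_classical all_reals all_analysis.
From mathcomp Require Import ring lra zify.

Set Implicit Arguments.
Unset Strict Implicit.
Unset Printing Implicit Defensive.

Import Order.TTheory GRing.Theory Num.Theory.
Import numFieldNormedType.Exports.

Local Open Scope classical_set_scope.
Local Open Scope ring_scope.

(** * Evaluation of homogeneous polynomials *)

Lemma mmap_rmorph n (K : nzRingType) (S T : comNzRingType) (f : K -> S)
    (phi : {rmorphism S -> T}) (h : 'I_n -> S) (p : mpoly n K) :
  phi (mmap f h p) = mmap (phi \o f) (phi \o h) p.
Proof.
rewrite /mmap rmorph_sum; apply: eq_bigr => m _.
rewrite rmorphM /mmap1 rmorph_prod; congr (_ * _).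
by apply: eq_bigr => i _; rewrite rmorphXn.
Qed.

Lemma eq_mmap n (K S : nzRingType) (f f' : K -> S) (h h' : 'I_n -> S)
    (p : mpoly n K) :
  f =1 f' -> h =1 h' -> mmap f h p = mmap f' h' p.
Proof.
move=> ff' hh'; rewrite /mmap; apply: eq_bigr => m _.
by rewrite ff' (mmap1_eq _ hh').
Qed.

Lemma mmap_homog_scale n (K : nzRingType) (S : comNzRingType) (f : K -> S)
    (h : 'I_n -> S) (p : mpoly n K) d (c : S) :
  p \is ishomog1 d (@mdeg n) ->
  mmap f (fun i => c * h i) p = c ^+ d * mmap f h p.
Proof.
move=> /dhomogP hp; rewrite /mmap mulr_sumr.
rewrite big_seq [RHS]big_seq; apply: eq_bigr => m mp.
rewrite [RHS]mulrCA; congr (_ * _).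
have <- : mdeg m = d := hp m mp.
rewrite /mmap1 mdegE -prodrXr -big_split/=.
by apply: eq_bigr => i _; rewrite exprMn.
Qed.

Lemma size_coef_mul (S : nzRingType) (u v : {poly S}) a b :
  (size u <= a.+1)%N -> (size v <= b.+1)%N ->
  (size (u * v)%R <= (a + b).+1)%N /\ (u * v)`_(a + b) = u`_a * v`_b.
Proof.
move=> ua vb; split.
  apply: leq_trans (size_polyMleq _ _) _.
  by have := leq_add ua vb; rewrite addSn addnS; case: (size u + size v)%N.
rewrite coefM (bigD1 (inord a)) //= inordK ?ltnS ?leq_addr// addKn big1 ?addr0//.
move=> i; rewrite -val_eqE/= inordK ?ltnS ?leq_addr// => ia.
have [lt_ia|le_ai] := ltnP i a.
  rewrite [v`__]nth_default ?mulr0//; apply: leq_trans vb _.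
  by move: lt_ia; lia.
rewrite nth_default ?mul0r//; apply: leq_trans ua _.
by rewrite ltn_neqAle eq_sym ia.
Qed.

Lemma size_coef_prod (S : comNzRingType) (I : Type) (s : seq I)
    (g : I -> {poly S}) (k : I -> nat) :
  (forall i, (size (g i) <= (k i).+1)%N) ->
  (size (\prod_(i <- s) g i)%R <= (\sum_(i <- s) k i).+1)%N /\
  (\prod_(i <- s) g i)`_(\sum_(i <- s) k i)%N = \prod_(i <- s) (g i)`_(k i).
Proof.
move=> gk; elim: s => [|i s [IH1 IH2]].
  by rewrite !big_nil size_poly1 coef1.
by rewrite !big_cons -IH2; exact: size_coef_mul.
Qed.

(** A monomial of degree [d] becomes a product of [d] affine factors, whose coefficient of degree
    [d] is the product of the slopes. A general ring [S] covers lines with real and with complex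
    coordinates. *)
Lemma mmap_line_top n (K : nzRingType) (S : comNzRingType) (f : K -> S)
    (u w : 'I_n -> S) (p : mpoly n K) d :
  p \is ishomog1 d (@mdeg n) ->
  let L := mmap (polyC \o f) (fun i => (u i)%:P + w i *: 'X) p in
  (size L <= d.+1)%N /\ L`_d = mmap f w p.
Proof.
move=> /dhomogP hp /=.
have lin i : (size ((u i)%:P + w i *: 'X)%R <= 2)%N.
  apply: leq_trans (size_polyD _ _) _; rewrite geq_max.
  rewrite (leq_trans (size_polyC_leq1 _))//=.
  by apply: leq_trans (size_scale_leq _ _) _; rewrite size_polyX.
have pw i k : (size (((u i)%:P + w i *: 'X) ^+ k)%R <= k.+1)%N /\
    (((u i)%:P + w i *: 'X) ^+ k)`_k = w i ^+ k.
  have := @size_coef_prod S 'I_k (index_enum _) (fun=> (u i)%:P + w i *: 'X) (fun=> 1%N).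
  move=> /(_ (fun=> lin i)).
  rewrite sum1_card card_ord !prodr_const card_ord => -[-> ->].
  by rewrite coefD coefC coefZ coefX /= mulr1 add0r.
have mono (m : multinom n) : mdeg m = d ->
   (size (mmap1 (fun i => (u i)%:P + w i *: 'X)%R m) <= d.+1)%N /\
   (mmap1 (fun i => (u i)%:P + w i *: 'X) m)`_d = mmap1 w m.
  move=> <-; rewrite mdegE /mmap1.
  have [] := @size_coef_prod S 'I_n (index_enum _)
     (fun i => ((u i)%:P + w i *: 'X) ^+ m i) m (fun i => (pw i _).1).
  move=> -> ->; split=> //; apply: eq_bigr => i _; exact: (pw i _).2.
split.
  rewrite /mmap big_seq; apply: (big_ind (fun L : {poly S} => size L <= d.+1)%N).
  - by rewrite size_poly0.
  - by move=> a b sa sb; rewrite (leq_trans (size_polyD _ _))// geq_max sa.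
  - move=> m mp /=; rewrite mul_polyC.
    by apply: leq_trans (size_scale_leq _ _) _; exact: (mono m (hp m mp)).1.
rewrite /mmap coef_sum big_seq [RHS]big_seq; apply: eq_bigr => m mp.
by rewrite /= coefCM (mono m (hp m mp)).2.
Qed.

Section Evaluation.
Context (R : realType).
Local Notation RC := (@real_complex_def R (Phant R)).

Definition cval n (p : mpoly n R) (z : 'I_n -> complex R) : complex R :=
  mmap RC z p.

Context (n : nat).
Implicit Types (p : mpoly n R) (x e a : 'cV[R]_n).

Lemma cval_real p x : cval p (fun i => RC (x i ord0)) = RC (peval p x).
Proof. by rewrite /peval /meval mmap_rmorph; exact: eq_mmap. Qed.

Lemma cval_conj p (z : 'I_n -> complex R) :
  cval p (fun i => conjc (z i)) = conjc (cval p z).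
Proof. by rewrite /cval mmap_rmorph; apply: eq_mmap => // r; exact/esym/conjc_real. Qed.

Lemma line_poly_horner p x e t : (line_poly p x e).[t] = peval p (x + t *: e).
Proof.
rewrite /line_poly -[_.[t]]/(horner_eval t _) mmap_rmorph; apply: eq_mmap => i /=.
  by rewrite /horner_eval hornerC.
by rewrite /horner_eval !hornerE !mxE mulrC.
Qed.

Lemma line_poly_chorner p x e z :
  (map_poly RC (line_poly p x e)).[z] =
  cval p (fun i => RC (x i ord0) + z * RC (e i ord0)).
Proof.
rewrite /line_poly mmap_rmorph -[_.[z]]/(horner_eval z _) mmap_rmorph.
apply: eq_mmap => i /=; rewrite /horner_eval.
  by rewrite map_polyC hornerC.
by rewrite rmorphD /= map_polyC map_polyZ map_polyX !hornerE mulrC.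
Qed.

Lemma peval_scale p d c x : p \is ishomog1 d (@mdeg n) ->
  peval p (c *: x) = c ^+ d * peval p x.
Proof.
move=> hp; rewrite /peval /meval -(mmap_homog_scale _ _ _ hp).
by apply: eq_mmap => i //; rewrite mxE.
Qed.

Lemma size_line_poly p d x e : p \is ishomog1 d (@mdeg n) ->
  peval p e != 0 ->
  size (line_poly p x e) = d.+1 /\ lead_coef (line_poly p x e) = peval p e.
Proof.
move=> hp pe; have [sz cf] := @mmap_line_top n R R idfun (fun i => x i ord0)
  (fun i => e i ord0) p d hp.
have szE : size (line_poly p x e) = d.+1.
  apply/eqP; rewrite eqn_leq sz/= ltnNge; apply/negP => sz'.
  by move/eqP: pe; apply; rewrite /peval /meval -cf nth_default.
by split=> //; rewrite lead_coefE szE.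
Qed.

(** The factorization over the complex numbers has only real roots, so it descends to [R]. *)
Lemma real_rooted_split (u : {poly R}) : real_rooted u ->
  exists rs : seq R, u = lead_coef u *: \prod_(r <- rs) ('X - r%:P).
Proof.
move=> ru; have [->|u0] := eqVneq u 0; first by exists [::]; rewrite lead_coef0 scale0r.
have [zs zsE] := closed_field_poly_normal (map_poly RC u).
have zs_real z : z \in zs -> RC (complex.Re z) = z.
  move=> zz; rewrite [RHS]complexE (ru z) ?rmorph0 ?mulr0 ?addr0//.
  by rewrite {}zsE rootZ ?lead_coef_eq0 ?map_poly_eq0// root_prod_XsubC.
exists (map (@complex.Re R) zs); apply: (map_poly_inj RC).
rewrite [LHS]zsE map_polyZ lead_coef_map; congr (_ *: _) => /=.
rewrite rmorph_prod/= big_map big_seq [RHS]big_seq; apply: eq_bigr => z zz.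
by rewrite rmorphB/= map_polyX map_polyC/= zs_real.
Qed.

End Evaluation.

(** * Real-rooted univariate polynomials *)

Section RealRooted.
Context (R : realType).
Local Notation RC := (@real_complex_def R (Phant R)).
Implicit Types (u : {poly R}) (rs : seq R).

Lemma Im_inv_sub (z : complex R) (r : R) : complex.Im z != 0 ->
  complex.Im ((z - RC r)^-1) * complex.Im z < 0.
Proof.
case: z => x y /= y0.
have y2 : 0 < y ^+ 2 by rewrite exprn_even_gt0.
have d0 : 0 < (x - r) ^+ 2 + (y - 0) ^+ 2.
  by rewrite subr0 ltr_wpDl// sqr_ge0.
have -> : - ((y - 0) / ((x - r) ^+ 2 + (y - 0) ^+ 2)) * y =
   - (y ^+ 2 / ((x - r) ^+ 2 + (y - 0) ^+ 2)).
  by rewrite subr0; ring.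
by rewrite oppr_lt0 divr_gt0.
Qed.

(* [W' / W] is the sum of the [1 / (z - r)], whose imaginary parts all have the
   sign opposite to that of [Im z]. *)
Lemma prod_XsubC_logderiv rs (z : complex R) : complex.Im z != 0 ->
  let W := \prod_(r <- rs) ('X - (RC r)%:P) in
  W.[z] != 0 /\
  (complex.Im (W^`().[z] / W.[z]) * complex.Im z < 0 \/ rs = [::]).
Proof.
move=> z0 /=; elim: rs => [|r rs [IH1 IH2]].
  by rewrite big_nil hornerC oner_eq0; split=> //; right.
have zr : z - RC r != 0.
  apply: contra z0; rewrite subr_eq0 => /eqP ->; exact/eqP.
have E : (\prod_(r <- r :: rs) ('X - (RC r)%:P)).[z] =
   (z - RC r) * (\prod_(r <- rs) ('X - (RC r)%:P)).[z].
  by rewrite big_cons !hornerE.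
split; first by rewrite E mulf_neq0.
left; rewrite {}E big_cons derivM derivXsubC !hornerE.
set W := \prod_(r <- rs) _ in IH1 IH2 *.
have -> : (W.[z] + (z - RC r) * W^`().[z]) / ((z - RC r) * W.[z]) =
    (z - RC r)^-1 + W^`().[z] / W.[z].
  by field; rewrite zr IH1.
have ImD (v w : complex R) : complex.Im (v + w) = complex.Im v + complex.Im w.
  by case: v w => [? ?] [? ?].
rewrite ImD mulrDl; have h := Im_inv_sub r z0.
case: IH2 => [IH2|rs0]; first by rewrite ltr_wnDl// ltW.
suff -> : W^`() = 0 by rewrite horner0 mul0r mul0r addr0.
by rewrite /W rs0 big_nil derivC.
Qed.

(** At a nonreal root [z] one has [a + b u'(z) / u(z) = 0]. The imaginary part of the quotient is
    nonzero, which forces [b = 0] and then [a = 0]. The size condition gives [u] a root, without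
    which the quotient would vanish. *)
Lemma real_rooted_comb u (a b : R) : real_rooted u -> (1 < size u)%N ->
  (a != 0) || (b != 0) -> real_rooted (a *: u + b *: u^`()).
Proof.
move=> ru su ab z rz; apply/eqP; apply: contraT => z0.
have u0 : u != 0 by rewrite -size_poly_gt0 ltnW.
have [rs uE] := real_rooted_split ru.
have [] := prod_XsubC_logderiv rs z0.
set W := \prod_(r <- rs) _ => W0 W'.
have WE : map_poly RC u = RC (lead_coef u) *: W.
  rewrite [in LHS]uE map_polyZ rmorph_prod; congr (_ *: _).
  by apply: eq_bigr => r _; rewrite rmorphB/= map_polyX map_polyC.
have l0 : RC (lead_coef u) != 0 by rewrite fmorph_eq0 lead_coef_eq0.
have {rz} : RC a + RC b * (W^`().[z] / W.[z]) = 0.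
  move: rz; rewrite rootE rmorphD/= !map_polyZ/= -deriv_map WE derivZ hornerD !hornerZ.
  move=> /eqP rz; apply: (mulfI (mulf_neq0 l0 W0)); rewrite mulr0 -rz.
  by field.
case: W' => [W'|rs0]; last first.
  by move: su; rewrite uE rs0 big_nil alg_polyC size_polyC; case: (_ != _).
move: W'; case: (_ / _) => x y /= xy [].
rewrite !mul0r subr0 addr0 add0r => h1 /eqP.
have y0 : y != 0 by apply: contraTneq xy => ->; rewrite mul0r ltxx.
rewrite mulf_eq0 (negbTE y0) orbF => /eqP b0.
by move: ab h1; rewrite b0 mul0r addr0 eqxx orbF => /eqP.
Qed.

Lemma real_rooted_pos_split u : real_rooted u ->
  (forall t, 0 <= t -> 0 < u.[t]) ->
  exists rs, [/\ 0 < lead_coef u, (forall r, r \in rs -> r < 0) &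
    u = lead_coef u *: \prod_(r <- rs) ('X - r%:P)].
Proof.
move=> ru upos; have [rs uE] := real_rooted_split ru.
have rs0 r : r \in rs -> r < 0.
  move=> rrs; rewrite ltNge; apply/negP => /upos; rewrite uE hornerZ.
  by have /rootP -> : root (\prod_(r <- rs) ('X - r%:P)) r;
    rewrite ?root_prod_XsubC// mulr0 ltxx.
exists rs; split=> //; have := upos 0 (lexx _).
rewrite {1}uE hornerZ pmulr_lgt0// horner_prod big_seq.
by apply: prodr_gt0 => r /rs0; rewrite !hornerE oppr_gt0.
Qed.

Lemma prod_XsubC_pos rs t : (forall r, r \in rs -> r < 0) -> 0 <= t ->
  let W := \prod_(r <- rs) ('X - r%:P) in
  [/\ 0 < W.[t], 0 <= W^`().[t] & 0 < W^`().[t] \/ rs = [::]].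
Proof.
move=> + t0; elim: rs => [|r rs IH] rs0 /=.
  by rewrite big_nil derivC hornerC horner0 ltr01; split=> //; right.
have [|/= W0 W'0 _] := IH; first by move=> x xrs; rewrite rs0// inE xrs orbT.
have tr : 0 < t - r.
  by rewrite subr_gt0 (lt_le_trans _ t0)// rs0// inE eqxx.
rewrite big_cons derivM derivXsubC !hornerE.
have W'1 : 0 < (\prod_(r <- rs) ('X - r%:P)).[t] +
    (t - r) * (\prod_(r <- rs) ('X - r%:P))^`().[t].
  by rewrite ltr_wpDr// mulr_ge0// ltW.
by split; [rewrite mulr_gt0|exact: ltW|left].
Qed.

Lemma real_rooted_pos_deriv u : real_rooted u ->
  (forall t, 0 <= t -> 0 < u.[t]) -> forall t, 0 <= t ->
  0 <= u^`().[t] /\ ((1 < size u)%N -> 0 < u^`().[t]).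
Proof.
move=> ru upos t t0; have [rs [l0 rs0 uE]] := real_rooted_pos_split ru upos.
have [/= _ h1 h2] := prod_XsubC_pos rs0 t0.
rewrite uE derivZ hornerZ; split; first by rewrite mulr_ge0// ltW.
case: h2 => [h2 _|->]; first by rewrite mulr_gt0.
by rewrite big_nil alg_polyC size_polyC; case: (_ != _).
Qed.

Lemma real_rooted_pos_homo u : real_rooted u ->
  (forall t, 0 <= t -> 0 < u.[t]) ->
  forall s t, 0 <= s -> s <= t -> u.[s] <= u.[t].
Proof.
move=> ru upos s t s0 st; have [rs [l0 rs0 ->]] := real_rooted_pos_split ru upos.
rewrite !hornerZ ler_pM2l// !horner_prod big_seq [leRHS]big_seq.
apply: ler_prod => r /rs0 r0; rewrite !hornerE lerB// andbT subr_ge0.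
by rewrite (le_trans (ltW r0)).
Qed.

(** Induction on the roots: for [u = (X - r) g] one has [u'^2 - u u'' = (t - r)^2 (g'^2 - g g'') +
    g^2] at [t]. *)
Lemma real_rooted_laguerre u t : real_rooted u ->
  u.[t] * u^`()^`().[t] <= u^`().[t] ^+ 2.
Proof.
move=> /real_rooted_split[rs ->]; rewrite !derivZ !hornerZ.
have : forall f : {poly R}, f = \prod_(r <- rs) ('X - r%:P) ->
    f.[t] * f^`()^`().[t] <= f^`().[t] ^+ 2.
  elim: rs => [|r rs IH] f ->.
    by rewrite big_nil !derivC !horner0 mulr0 expr0n.
  rewrite big_cons; set g := \prod_(r <- rs) _.
  have := IH g erefl.
  rewrite derivM derivXsubC mul1r derivD derivM derivXsubC mul1r.
  rewrite !hornerD !hornerM !hornerD hornerN hornerX hornerC.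
  move: g.[t] g^`().[t] g^`()^`().[t] => a b c ac.
  have : 0 <= (t - r) ^+ 2 * (b ^+ 2 - a * c).
    by rewrite mulr_ge0 ?sqr_ge0// subr_ge0.
  have : 0 <= a ^+ 2 by rewrite sqr_ge0.
  by nra.
move=> /(_ _ erefl); set g := \prod_(r <- rs) _ => h.
by rewrite exprMn mulrACA -expr2 ler_wpM2l// sqr_ge0.
Qed.

End RealRooted.

(** * Directional derivatives *)

Lemma horner_inj (R : realType) (u v : {poly R}) : horner u =1 horner v -> u = v.
Proof.
move=> uv; apply/eqP; rewrite -subr_eq0; apply/eqP.
have [k hk] : exists k, k = size (u - v) by exists (size (u - v)).
apply: (@roots_geq_poly_eq0 _ _ (map (fun i => i%:R : R) (iota 0 k))).
- by apply/allP => r _; rewrite rootE hornerD hornerN uv subrr.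
- by rewrite map_inj_uniq ?iota_uniq// => i j /eqP; rewrite eqr_nat => /eqP.
- by rewrite size_map size_iota hk.
Qed.

Section Directional.
Context (R : realType) (n : nat).
Implicit Types (p q : mpoly n R) (x y e v a : 'cV[R]_n).

(** The directional derivative as a polynomial, so that it can itself be hyperbolic and be
    differentiated again. *)
Definition ddir p v : mpoly n R := \sum_i v i ord0 *: mderiv i p.

(** Substitution along the line is a ring morphism [rho], and both sides obey the Leibniz rule.
    Agreement on 1 and on the variables spreads to monomials, then by linearity to all
    polynomials. *)
Lemma line_poly_deriv p x v : (line_poly p x v)^`() = line_poly (ddir p v) x v.
Proof.
pose rho := mmap (@polyC R) (fun i => (x i ord0)%:P + v i ord0 *: 'X).
pose D q := (rho q)^`() = rho (ddir q v).
have rhoD : {morph rho : q1 q2 / q1 + q2} by move=> ? ?; exact: rmorphD.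
have rhoM : {morph rho : q1 q2 / q1 * q2} by move=> ? ?; exact: rmorphM.
have rhoZ c q : rho (c *: q) = c *: rho q by rewrite /rho mmapZ mul_polyC.
have DZD c q1 q2 : D q1 -> D q2 -> D (c *: q1 + q2).
  rewrite /D => d1 d2; rewrite rhoD rhoZ derivD derivZ d1 d2.
  have -> : ddir (c *: q1 + q2) v = c *: ddir q1 v + ddir q2 v.
    rewrite /ddir scaler_sumr -big_split; apply: eq_bigr => i _ /=.
    by rewrite mderivD mderivZ scalerDr !scalerA mulrC.
  by rewrite rhoD rhoZ.
have DM q1 q2 : D q1 -> D q2 -> D (q1 * q2).
  rewrite /D => d1 d2; rewrite rhoM derivM d1 d2.
  have -> : ddir (q1 * q2) v = ddir q1 v * q2 + q1 * ddir q2 v.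
    rewrite /ddir mulr_suml mulr_sumr -big_split; apply: eq_bigr => i _.
    by rewrite mderivM scalerDr scalerAl scalerAr.
  by rewrite rhoD !rhoM.
have D1 : D 1.
  rewrite /D /rho rmorph1 derivC /ddir big1 ?rmorph0// => i _.
  by rewrite (mderivC _ 1) scaler0.
have DX i : D (mpolyX R (mnm1 i)).
  rewrite /D /rho mmapX mmap1U derivD derivC derivZ derivX add0r.
  rewrite alg_polyC /ddir (bigD1 i)//= mderivX mnm1E eqxx scale1r.
  have -> : mnm_sub (mnm1 i) (mnm1 i) = mnm0 by apply/mnmP => k; rewrite mnmBE subnn mnm0E.
  rewrite big1 ?addr0; first by rewrite mpolyX0 alg_mpolyC mmapC.
  move=> j ji; rewrite mderivX mnm1E.
  by rewrite eq_sym (negbTE ji) scale0r scaler0.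
change (D p); elim/mpolyind: p => [|c m p _ _ Dp].
  by rewrite /D /rho rmorph0 deriv0 /ddir big1 ?rmorph0// => i _; rewrite mderiv0 scaler0.
have DXm : D (mpolyX R m).
  rewrite mpolyXE_id; apply: (big_ind D) => // i _.
  by elim: (m i) => // k IH; rewrite exprS; exact: DM.
exact: DZD.
Qed.

Lemma line_poly_deriv_horner p x v t :
  (line_poly p x v)^`().[t] = peval (ddir p v) (x + t *: v).
Proof. by rewrite line_poly_deriv line_poly_horner. Qed.

Lemma peval_ddir p v x :
  peval (ddir p v) x = \sum_i v i ord0 * peval (mderiv i p) x.
Proof.
rewrite /peval /ddir raddf_sum; apply: eq_bigr => i _; exact: mevalZ.
Qed.

Lemma peval_ddirD p v w x :
  peval (ddir p (v + w)) x = peval (ddir p v) x + peval (ddir p w) x.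
Proof.
by rewrite !peval_ddir -big_split; apply: eq_bigr => i _; rewrite mxE mulrDl.
Qed.

Lemma peval_ddirZ p c v x : peval (ddir p (c *: v)) x = c * peval (ddir p v) x.
Proof.
by rewrite !peval_ddir mulr_sumr; apply: eq_bigr => i _; rewrite mxE mulrA.
Qed.

Lemma ddir_homog p v d : p \is ishomog1 d.+1 (@mdeg n) ->
  ddir p v \is ishomog1 d (@mdeg n).
Proof.
move=> /dhomogP hp; apply: rpred_sum => i _; apply: rpredZ.
apply/dhomogP => m; rewrite mcoeff_msupp mcoeff_mderiv => mp.
have : mdeg (mnm_add m (mnm1 i)) = d.+1.
  by apply: hp; rewrite mcoeff_msupp; apply: contraNneq mp => ->; rewrite mul0rn.
by rewrite mdegD mdeg1 addn1 => -[].
Qed.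

(** By homogeneity [p (x + t x) = (1 + t)^d p(x)]; the two sides are differentiated at [t = 0]. *)
Lemma euler_identity p x d : p \is ishomog1 d (@mdeg n) ->
  peval (ddir p x) x = d%:R * peval p x.
Proof.
move=> hp; have := line_poly_deriv_horner p x x 0.
rewrite scale0r addr0 => <-.
have -> : line_poly p x x = peval p x *: ('X + 1%:P) ^+ d.
  apply: horner_inj => t; rewrite line_poly_horner -{1}(scale1r x) -scalerDl.
  by rewrite (peval_scale _ _ hp) !hornerE addrC mulrC.
rewrite derivZ deriv_exp derivD derivX derivC addr0 !hornerE.
by rewrite hornerMn !hornerE expr1n mulrC.
Qed.

Lemma differentiable_peval p x : differentiable (peval p) x.
Proof.
have dsum (I : Type) (s : seq I) (F : I -> 'cV[R]_n -> R) :
    (forall i, differentiable (F i) x) ->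
    differentiable (fun y => \sum_(i <- s) F i y) x.
  move=> dF; elim: s => [|i s IH].
    by rewrite (_ : (fun _ => _) = cst 0) ?funeqE// => y; rewrite big_nil.
  rewrite (_ : (fun _ => _) = F i + fun y => \sum_(i <- s) F i y).
    exact: differentiableD.
  by rewrite funeqE => y; rewrite big_cons.
have dprod (I : Type) (s : seq I) (F : I -> 'cV[R]_n -> R) :
    (forall i, differentiable (F i) x) ->
    differentiable (fun y => \prod_(i <- s) F i y) x.
  move=> dF; elim: s => [|i s IH].
    by rewrite (_ : (fun _ => _) = cst 1) ?funeqE// => y; rewrite big_nil.
  rewrite (_ : (fun _ => _) = F i * fun y => \prod_(i <- s) F i y).
    exact: differentiableM.
  by rewrite funeqE => y; rewrite big_cons.
apply: (dsum _ (msupp p)) => m; apply: differentiableM => //.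
apply: dprod => i.
rewrite (_ : (fun _ => _) = (fun y : 'cV[R]_n => y i ord0) ^+ m i).
  case: (m i) => [|k]; first by rewrite expr0; exact: differentiable_cst.
  by apply: differentiableX; exact: differentiable_coord.
by rewrite funeqE => y; rewrite exprfctE.
Qed.

Lemma continuous_peval p : continuous (peval p).
Proof. by move=> x; exact/differentiable_continuous/differentiable_peval. Qed.

Lemma dirderivE p e x : dirderiv p e x = peval (ddir p e) x.
Proof.
rewrite /dirderiv -deriveE; last exact: differentiable_peval.
have := line_poly_deriv_horner p x e 0; rewrite scale0r addr0 => <-.
rewrite derivE derive1E /derive; set L := line_poly p x e.
(* The two derivatives are limits of the same difference quotient, [F] for [peval p] along [e] and
   [G] for the line polynomial at 0. *)
pose F (h : R) : R := h^-1 *: ((peval p \o shift x) (h *: e) - peval p x).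
pose G (h : R) : R := h^-1 *: ((horner L \o shift 0) (h *: 1) - L.[0]).
suff FG : F = G by change (lim (F @ 0^') = lim (G @ 0^')); rewrite FG.
rewrite funeqE => h; rewrite /F /G; congr (_ *: _).
rewrite /= [h *: 1]mulr1 !line_poly_horner addr0 scale0r addr0.
by rewrite [h *: e + x]addrC.
Qed.

End Directional.

(** * Hyperbolicity cones *)

Lemma closed_ge0_fun (R : realType) (T : topologicalType) (f : T -> R) :
  continuous f -> closed [set z | 0 <= f z].
Proof. by move=> cf; exact: (preimage_closed (fun z _ => cf z) (@closed_ge R 0)). Qed.

Section HyperbolicityCone.
Context (R : realType) (n : nat).
Implicit Types (p : mpoly n R) (x y a : 'cV[R]_n).

Definition hcone p a : set 'cV[R]_n :=
  [set y | forall t, 0 <= t -> 0 < peval p (y + t *: a)].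

Lemma hcone_pos p a y : hcone p a y -> 0 < peval p y.
Proof. by move=> /(_ 0 (lexx _)); rewrite scale0r addr0. Qed.

Lemma hcone_shift p a y t : 0 <= t -> hcone p a y -> hcone p a (y + t *: a).
Proof. by move=> t0 ya s s0; rewrite -addrA -scalerDl; apply: ya; rewrite addr_ge0. Qed.

Lemma hcone_homo p a y : hyperbolic p a -> hcone p a y ->
  forall s t, 0 <= s -> s <= t -> peval p (y + s *: a) <= peval p (y + t *: a).
Proof.
move=> [_ _ rp] ya s t s0 st; rewrite -!line_poly_horner.
by apply: real_rooted_pos_homo => // r r0; rewrite line_poly_horner; exact: ya.
Qed.

(** Up to positive factors, the ray [y + t a] with [t >= 0] is the segment from [y] to [a] without
    the endpoint [a]. The full segment is compact and connected, which the ray description does not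
    exploit. *)
Lemma hcone_segmentP p a y : homogeneous p -> 0 < peval p a ->
  (hcone p a y <-> forall s, s \in `[0, 1] -> 0 < peval p (s *: y + (1 - s) *: a)).
Proof.
move=> [d hp] pa; split=> [ya s|ya t t0].
  rewrite in_itv/= => /andP[s0 s1]; have [->|sn0] := eqVneq s 0.
    by rewrite scale0r add0r subr0 scale1r.
  have -> : s *: y + (1 - s) *: a = s *: (y + ((1 - s) / s) *: a).
    by rewrite scalerDr scalerA mulrC divfK.
  have {}s0 : 0 < s by rewrite lt_neqAle eq_sym sn0.
  rewrite (peval_scale _ _ hp) mulr_gt0 ?exprn_gt0//; apply: ya.
  by rewrite divr_ge0 ?subr_ge0// ltW.
have t1 : 0 < 1 + t by rewrite ltr_pwDl.
have -> : y + t *: a = (1 + t) *: ((1 + t)^-1 *: y + (1 - (1 + t)^-1) *: a).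
  by rewrite scalerDr !scalerA mulrBr mulr1 divff ?gt_eqF// scale1r addrAC subrr add0r.
rewrite (peval_scale _ _ hp) mulr_gt0 ?exprn_gt0//; apply: ya.
by rewrite in_itv/= invr_ge0 ltW//= invf_le1// lerDl.
Qed.

Lemma hcone_dir p a : homogeneous p -> 0 < peval p a -> hcone p a a.
Proof.
move=> hp pa; apply/hcone_segmentP => // s _.
by rewrite -scalerDl addrC subrK scale1r.
Qed.

(** Compactness of [[0, 1]] yields a neighbourhood of [y] that serves all [s] at once. *)
Lemma open_hcone p a : homogeneous p -> 0 < peval p a -> open (hcone p a).
Proof.
move=> hp pa; rewrite openE => y /(hcone_segmentP _ hp pa) ya.
have [+ _] := compact_near_coveringP `[(0 : R), 1].
move=> /(_ (@segment_compact _ _ _)).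
move=> /(_ _ (nbhs y) (fun z (s : R) => 0 < peval p (s *: z + (1 - s) *: a)) _).
have near_seg (s : R) : s \in `[0, 1]%R -> \forall s' \near s & z \near y,
    0 < peval p (s' *: z + (1 - s') *: a).
  move=> s01.
  have cf : continuous (fun w : R * 'cV[R]_n =>
     peval p (w.1 *: w.2 + (1 - w.1) *: a)).
    move=> w; apply: (@continuous_comp _ _ _
      (fun w : R * 'cV[R]_n => w.1 *: w.2 + (1 - w.1) *: a) (peval p)); last first.
      exact: continuous_peval.
    apply: cvgD; first by apply: cvgZ; [exact: cvg_fst|exact: cvg_snd].
    apply: cvgZ; last exact: cvg_cst.
    by apply: cvgB; [exact: cvg_cst|exact: cvg_fst].
  have /= := cf (s, y) [set r | 0 < r]; apply.
  by apply: open_nbhs_nbhs; split; [exact: open_gt|exact: ya].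
move=> /(_ near_seg); apply: filterS => z hz.
by apply/hcone_segmentP => // s s01; exact: hz.
Qed.

(** The cone is open and closed relative to [{p > 0}]: by monotonicity [p (y + t a) >= p y] on the
    cone, and this survives limits. Conversely, the segment from [a] to [y] is a connected part of
    [{p > 0}]. *)
Lemma pos_component_hcone p a : hyperbolic p a ->
  pos_component (peval p) a = hcone p a.
Proof.
move=> hyp; have [hp pa rp] := hyp; apply/seteqP; split=> y.
  move=> [B [Ba Bpos cB] By].
  suff E : B `&` hcone p a = B by move: By; rewrite -E => -[].
  apply: cB.
  - by exists a; split=> //; exact: hcone_dir.
  - by exists (hcone p a) => //; exact: open_hcone.
  exists (closure (hcone p a)); first exact: closed_closure.
  apply/seteqP; split=> z [Bz za]; split=> //; first exact: subset_closure.
  move=> t t0; apply: lt_le_trans (Bpos z Bz) _.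
  have cl : closed [set z : 'cV[R]_n | 0 <= peval p (z + t *: a) - peval p z].
    have ct : continuous (fun z : 'cV[R]_n => peval p (z + t *: a)).
      move=> w; apply: (@continuous_comp _ _ _ (fun z : 'cV[R]_n => z + t *: a) (peval p)).
        by apply: continuousD; [exact: cvg_id|exact: cst_continuous].
      exact: continuous_peval.
    apply: closed_ge0_fun => w.
    apply: (@continuousB _ _ _ (fun z : 'cV[R]_n => peval p (z + t *: a)) (peval p)).
      exact: ct.
    exact: continuous_peval.
  rewrite -subr_ge0; move: z za {Bz}; rewrite closureE; apply: smallest_sub => //.
  move=> z za /=; rewrite subr_ge0.
  by have := hcone_homo hyp za (lexx 0) t0; rewrite scale0r addr0.
move=> /(hcone_segmentP _ hp pa) ya.
exists ((fun s : R => s *: y + (1 - s) *: a) @` `[0, 1]); last first.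
  by exists 1; rewrite ?bound_itvE/= ?in_itv/= ?lexx ?ler01// scale1r subrr scale0r addr0.
split.
- by exists 0; rewrite /= ?in_itv/= ?lexx ?ler01// scale0r subr0 scale1r add0r.
- by move=> _ [s s01 <-]; exact: ya.
- apply: connected_continuous_connected; first exact: segment_connected.
  apply: continuous_subspaceT => s.
  apply: cvgD; first by apply: cvgZ; [exact: cvg_id|exact: cvg_cst].
  apply: cvgZ; last exact: cvg_cst.
  by apply: cvgB; [exact: cvg_cst|exact: cvg_id].
Qed.

End HyperbolicityCone.

(** * Garding's theorem *)

Section SquaredModulus.
Context (R : realType).
Local Notation C := (complex R).
Local Notation RC := (@real_complex_def R (Phant R)).
Implicit Types z w : C.

(** Real-valued, multiplicative and polynomial in the two parts: estimates on complex values become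
    statements on continuous real functions. *)
Definition sqmod z : R := complex.Re z ^+ 2 + complex.Im z ^+ 2.

Lemma sqmod_ge0 z : 0 <= sqmod z.
Proof. by rewrite addr_ge0 ?sqr_ge0. Qed.

Lemma sqmodM z w : sqmod (z * w) = sqmod z * sqmod w.
Proof. by case: z w => [a b] [c d]; rewrite /sqmod /=; ring. Qed.

Lemma sqmod_real (r : R) : sqmod (RC r) = r ^+ 2.
Proof. by rewrite /sqmod /= expr0n addr0. Qed.

Lemma sqmod_prod (I : Type) (s : seq I) (F : I -> C) :
  sqmod (\prod_(i <- s) F i) = \prod_(i <- s) sqmod (F i).
Proof.
elim: s => [|i s IH]; first by rewrite !big_nil /sqmod /= expr0n addr0 expr1n.
by rewrite !big_cons sqmodM IH.
Qed.

Lemma sqmod_eq0 z : (sqmod z == 0) = (z == 0).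
Proof.
case: z => a b; rewrite /sqmod paddr_eq0 ?sqr_ge0// !sqrf_eq0 eq_complex.
by [].
Qed.

(** Continuity by coordinates keeps all limits in [R]. *)
Definition ccontinuous (T : topologicalType) (f : T -> C) :=
  continuous (fun t => complex.Re (f t)) /\ continuous (fun t => complex.Im (f t)).

Section Ccontinuous.
Context (T : topologicalType).
Implicit Types f g : T -> C.

Lemma ccontinuous_cst z : ccontinuous (fun _ : T => z).
Proof. by split=> t; exact: cvg_cst. Qed.

Lemma ccontinuousD f g : ccontinuous f -> ccontinuous g ->
  ccontinuous (fun t => f t + g t).
Proof.
move=> [f1 f2] [g1 g2]; split.
  rewrite (_ : (fun t => _) = (fun t => complex.Re (f t) + complex.Re (g t))).
    by move=> t; apply: cvgD; [exact: f1|exact: g1].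
  by apply/funext => t; case: (f t) (g t) => [? ?] [].
rewrite (_ : (fun t => _) = (fun t => complex.Im (f t) + complex.Im (g t))).
  by move=> t; apply: cvgD; [exact: f2|exact: g2].
by apply/funext => t; case: (f t) (g t) => [? ?] [].
Qed.

Lemma ccontinuousM f g : ccontinuous f -> ccontinuous g ->
  ccontinuous (fun t => f t * g t).
Proof.
move=> [f1 f2] [g1 g2]; split.
  rewrite (_ : (fun t => _) = (fun t => complex.Re (f t) * complex.Re (g t) -
     complex.Im (f t) * complex.Im (g t))).
    by move=> t; apply: cvgB; apply: cvgM; [exact: f1|exact: g1|exact: f2|exact: g2].
  by apply/funext => t; case: (f t) (g t) => [? ?] [].
rewrite (_ : (fun t => _) = (fun t => complex.Re (f t) * complex.Im (g t) +
   complex.Im (f t) * complex.Re (g t))).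
  by move=> t; apply: cvgD; apply: cvgM; [exact: f1|exact: g2|exact: f2|exact: g1].
by apply/funext => t; case: (f t) (g t) => [? ?] [].
Qed.

Lemma ccontinuous_real (h : T -> R) : continuous h -> ccontinuous (fun t => RC (h t)).
Proof. by move=> ch; split=> // t; exact: cvg_cst. Qed.

Lemma ccontinuous_sqmod f : ccontinuous f -> continuous (fun t => sqmod (f t)).
Proof.
move=> [f1 f2] t; apply: cvgD; apply: cvgM; by [exact: f1|exact: f2].
Qed.

Lemma ccontinuous_cval n (p : mpoly n R) (z : T -> 'I_n -> C) :
  (forall i, ccontinuous (fun t => z t i)) -> ccontinuous (fun t => cval p (z t)).
Proof.
move=> cz; rewrite /cval /mmap; elim: (msupp p) => [|m s IH].
  rewrite (_ : (fun _ => _) = fun=> 0); first exact: ccontinuous_cst.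
  by apply/funext => t; rewrite big_nil.
rewrite (_ : (fun _ => _) = fun t => RC (mcoeff m p) * mmap1 (z t) m +
    \sum_(m <- s) RC (mcoeff m p) * mmap1 (z t) m); last first.
  by apply/funext => t; rewrite big_cons.
apply: ccontinuousD => //; apply: ccontinuousM; first exact: ccontinuous_cst.
rewrite /mmap1; elim: (index_enum _) => [|i r IHr].
  rewrite (_ : (fun _ => _) = fun=> 1); first exact: ccontinuous_cst.
  by apply/funext => t; rewrite big_nil.
rewrite (_ : (fun _ => _) = fun t => z t i ^+ m i * \prod_(i <- r) z t i ^+ m i); last first.
  by apply/funext => t; rewrite big_cons.
apply: ccontinuousM => //; elim: (m i) => [|k IHk].
  by under eq_fun do rewrite expr0; exact: ccontinuous_cst.
by under eq_fun do rewrite exprS; exact: ccontinuousM.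
Qed.

End Ccontinuous.

Lemma continuous_ge_limit (f : R -> R) (c x : R) : continuous f ->
  (forall e, 0 < e -> exists2 y, `|x - y| < e & c <= f y) -> c <= f x.
Proof.
move=> cf h; rewrite leNgt; apply/negP => fc.
have /nbhs_ballP[e /= e0 he] : \forall y \near x, f y < c.
  have := cf x [set r | r < c]; apply; apply: open_nbhs_nbhs; split=> //.
have [y xy cfy] := h e e0.
by have := he y xy; rewrite /= ltNge cfy.
Qed.

End SquaredModulus.

(** * Zeros with complex coordinates *)

Section Garding.
Context (R : realType) (n : nat).
Local Notation C := (complex R).
Local Notation RC := (@real_complex_def R (Phant R)).
Implicit Types (p : mpoly n R) (x y a : 'cV[R]_n).

Lemma ImD (z w : C) : complex.Im (z + w) = complex.Im z + complex.Im w.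
Proof. by case: z w => [? ?] []. Qed.

Lemma Im_realM (r : R) (z : C) : complex.Im (RC r * z) = r * complex.Im z.
Proof. by case: z => u v; rewrite /= mul0r addr0. Qed.

(* The line polynomial in [z] has leading coefficient [p y] and degree [d], and
   its roots lie below the real axis, at distance at least [Im z] from [z]. *)
Lemma cval_lower_bound p d y (u : 'I_n -> C) (z : C) :
  p \is ishomog1 d (@mdeg n) -> 0 < peval p y ->
  (forall w, 0 <= complex.Im w ->
    cval p (fun i => u i + w * RC (y i ord0)) != 0) ->
  0 <= complex.Im z ->
  (peval p y * complex.Im z ^+ d) ^+ 2 <=
  sqmod (cval p (fun i => u i + z * RC (y i ord0))).
Proof.
move=> hp py nz z0.
pose L := mmap (polyC \o RC) (fun i => (u i)%:P + RC (y i ord0) *: 'X) p.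
have LE w : L.[w] = cval p (fun i => u i + w * RC (y i ord0)).
  rewrite -[L.[w]]/(horner_eval w _) mmap_rmorph; apply: eq_mmap => i /=.
    by rewrite /horner_eval hornerC.
  by rewrite /horner_eval !hornerE mulrC.
have [sL cL] : (size L <= d.+1)%N /\ L`_d = RC (peval p y).
  by rewrite -cval_real; exact: mmap_line_top.
have py0 : RC (peval p y) != 0 by rewrite fmorph_eq0 gt_eqF.
have szL : size L = d.+1.
  apply/eqP; rewrite eqn_leq sL/= ltnNge; apply/negP => sz.
  by move: py0; rewrite -cL nth_default ?eqxx.
have lL : lead_coef L = RC (peval p y) by rewrite lead_coefE szL.
have [rs rsE] := closed_field_poly_normal L.
have srs : size rs = d.
  move: szL; rewrite rsE lL size_scale// size_prod_XsubC => -[].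
  by [].
have rs0 r : r \in rs -> complex.Im r < 0.
  move=> rrs; rewrite ltNge; apply/negP => /nz; rewrite -LE -rootE => /negP; apply.
  by rewrite rsE rootZ ?lL// root_prod_XsubC.
rewrite -LE rsE lL hornerZ sqmodM sqmod_real exprMn ler_pM2l ?exprn_gt0//.
rewrite horner_prod sqmod_prod -srs -[size rs]card_ord -prodr_const.
rewrite (big_nth 0) big_mkord -prodrXl.
apply: ler_prod => i _; rewrite sqr_ge0/= !hornerE.
have := rs0 _ (mem_nth 0 (ltn_ord i)).
case: (rs`_i) => s t /= t0; case: z z0 => v w /= w0.
rewrite /sqmod /= ler_wpDl ?sqr_ge0// ler_pXn2r ?nnegrE//.
  by rewrite lerDl oppr_ge0 ltW.
by rewrite addr_ge0// oppr_ge0 ltW.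
Qed.

Lemma cval_scale p d (c : C) (u : 'I_n -> C) : p \is ishomog1 d (@mdeg n) ->
  cval p (fun i => c * u i) = c ^+ d * cval p u.
Proof. exact: mmap_homog_scale. Qed.

Lemma eq_cval p (u w : 'I_n -> C) : u =1 w -> cval p u = cval p w.
Proof. exact: eq_mmap. Qed.

Lemma cval_imag_dir p a x (al : R) : hyperbolic p a -> 0 < al ->
  cval p (fun i => Complex 0 al * RC (a i ord0) + RC (x i ord0)) != 0.
Proof.
move=> [_ _ rp] al0; apply/negP => /eqP h.
have := rp x (Complex 0 al) _; rewrite rootE line_poly_chorner.
rewrite (@eq_cval p _ (fun i => Complex 0 al * RC (a i ord0) + RC (x i ord0))); last first.
  by move=> i; rewrite addrC.
by rewrite h eqxx => /(_ isT) /=; move/eqP; rewrite gt_eqF.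
Qed.

(** For [z != 0], homogeneity turns a zero into the root [w = i al / z] of [t |-> p (y + t a)]. It
    is real by hyperbolicity and negative because [y] is in the cone, whereas [w Im z = al > 0] and
    [Im z >= 0]. *)
Lemma cval_base p a y (al : R) (z : C) : hyperbolic p a -> hcone p a y ->
  0 < al -> 0 <= complex.Im z ->
  cval p (fun i => Complex 0 al * RC (a i ord0) + z * RC (y i ord0)) != 0.
Proof.
move=> [[d hp] pa rp] ya al0 z0; apply/negP => /eqP h.
have ial : Complex 0 al != 0 by rewrite eq_complex /= eqxx gt_eqF.
have pa0 : RC (peval p a) != 0 by rewrite fmorph_eq0 gt_eqF.
have [z00|zn0] := eqVneq z 0.
  move: h; rewrite z00 (@eq_cval p _ (fun i => Complex 0 al * RC (a i ord0))).
    rewrite (cval_scale _ _ hp) cval_real => /eqP.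
    by rewrite mulf_eq0 expf_eq0 (negbTE ial) andbF (negbTE pa0).
  by move=> i; rewrite mul0r addr0.
have : root (map_poly RC (line_poly p y a)) (Complex 0 al / z).
  rewrite rootE line_poly_chorner.
  move: h; rewrite (@eq_cval p _ (fun i => z * (RC (y i ord0) + Complex 0 al / z * RC (a i ord0)))).
    by rewrite (cval_scale _ _ hp) => /eqP; rewrite mulf_eq0 expf_eq0 (negbTE zn0) andbF.
  by move=> i; rewrite mulrDr mulrA [z * (_ / z)]mulrC divfK// addrC.
move=> rt; have := rp _ _ rt; set w := Complex 0 al / z in rt * => w0.
have wE : w = RC (complex.Re w) by case: w w0 {rt} => s t /= ->.
have wz : w * z = Complex 0 al by rewrite /w divfK.
have : 0 <= complex.Re w -> False.
  move=> wpos; move: rt; rewrite rootE wE.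
  rewrite -[RC _]/(RC (complex.Re w)) horner_map/= fmorph_eq0 line_poly_horner.
  by rewrite gt_eqF// ya.
apply; have : complex.Re w * complex.Im z = al by rewrite -Im_realM -wE wz.
rewrite leNgt; move=> E; apply/negP => wneg.
by move: al0; rewrite -E ltNge mulr_le0_ge0// ltW.
Qed.

End Garding.

Section GardingTransfer.
Context (R : realType) (n : nat).
Local Notation C := (complex R).
Local Notation RC := (@real_complex_def R (Phant R)).
Implicit Types (p : mpoly n R) (x y a : 'cV[R]_n).

(* At the least [r >= 0] with a zero [z] in the closed upper half plane,
   [r > 0] by [cval_base]; the bound of [cval_lower_bound] for smaller parameters
   passes to the limit and makes [z] real, against hyperbolicity along [a]. *)
Lemma cval_homotopy p a y x (al r1 : R) (z1 : C) :
  hyperbolic p a -> hcone p a y -> 0 < al -> 0 <= r1 -> 0 <= complex.Im z1 ->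
  cval p (fun i => (Complex 0 al * RC (a i ord0) + RC r1 * RC (x i ord0)) +
                   z1 * RC (y i ord0)) != 0.
Proof.
move=> hyp ya al0 r10 z10; apply/negP => /eqP h1.
have [[d hp] pa rp] := hyp.
have py := hcone_pos ya.
pose u (r : R) i := Complex 0 al * RC (a i ord0) + RC r * RC (x i ord0).
pose f (r : R) z := cval p (fun i => u r i + z * RC (y i ord0)).
pose G (w : (R * R) * (R * R)) := cval p (fun i =>
  RC w.2.2 * (Complex 0 al * RC (a i ord0) + RC w.1.1 * RC (x i ord0)) +
  (RC w.1.2 + Complex 0 1 * RC w.2.1) * RC (y i ord0)).
(* The unit sphere in the homogeneous coordinates excludes the trivial zero of [G]. *)
pose nrm (w : (R * R) * (R * R)) := w.1.2 ^+ 2 + w.2.1 ^+ 2 + w.2.2 ^+ 2.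
pose box := ((`[(0 : R), r1] `*` `[(-1 : R), 1]) `*` (`[(0 : R), 1] `*` `[(0 : R), 1]))%classic.
(* Both equations [nrm w = 1] and [G w = 0] as one sign condition on a continuous function, so that
   [Z] is closed. *)
pose Z := [set w | 0 <= - ((nrm w - 1) ^+ 2 + sqmod (G w))].
have ZP w : Z w <-> nrm w = 1 /\ G w = 0.
  rewrite /Z/= oppr_ge0; split=> [h|[-> ->]]; last first.
    by rewrite subrr /sqmod/= expr0n !addr0.
  have : (nrm w - 1) ^+ 2 + sqmod (G w) == 0.
    by rewrite eq_le h addr_ge0 ?sqr_ge0 ?sqmod_ge0.
  rewrite paddr_eq0 ?sqr_ge0 ?sqmod_ge0// sqrf_eq0 sqmod_eq0 subr_eq0.
  by move=> /andP[/eqP-> /eqP->].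
have c11 : continuous (fun w : (R * R) * (R * R) => w.1.1).
  by move=> w; apply: (@continuous_comp _ _ _ fst fst); exact: cvg_fst.
have c12 : continuous (fun w : (R * R) * (R * R) => w.1.2).
  by move=> w; apply: (@continuous_comp _ _ _ fst snd); [exact: cvg_fst|exact: cvg_snd].
have c21 : continuous (fun w : (R * R) * (R * R) => w.2.1).
  by move=> w; apply: (@continuous_comp _ _ _ snd fst); [exact: cvg_snd|exact: cvg_fst].
have c22 : continuous (fun w : (R * R) * (R * R) => w.2.2).
  by move=> w; apply: (@continuous_comp _ _ _ snd snd); exact: cvg_snd.
have cG : ccontinuous G.
  apply: ccontinuous_cval => i; apply: ccontinuousD; apply: ccontinuousM.
  - exact: ccontinuous_real.
  - apply: ccontinuousD; first exact: ccontinuous_cst.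
    by apply: ccontinuousM; [exact: ccontinuous_real|exact: ccontinuous_cst].
  - apply: ccontinuousD; first exact: ccontinuous_real.
    by apply: ccontinuousM; [exact: ccontinuous_cst|exact: ccontinuous_real].
  - exact: ccontinuous_cst.
have clZ : closed Z.
  apply: closed_ge0_fun => w; apply: cvgN; apply: cvgD; last exact: ccontinuous_sqmod.
  by apply: cvgM; (apply: cvgB; [apply: cvgD; [apply: cvgD|]; apply: cvgM;
    by [exact: c12|exact: c21|exact: c22]|exact: cvg_cst]).
have cK : compact (box `&` Z).
  apply: compact_closedI => //.
  by apply: compact_setX; apply: compact_setX; exact: segment_compact.
(* [G] homogenizes [f]: ((r, s1), (s2, k)) stands for the zero (s1 + i s2) / k
   of [f r], so the unbounded set of zeros becomes a compact set. *)
have memK r z : 0 <= r <= r1 -> 0 <= complex.Im z -> f r z = 0 ->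
    exists2 w, (box `&` Z) w & w.1.1 = r.
  move=> rr1 z0 frz; case: z z0 frz => s t /= t0 frz.
  (* The Euclidean norm of [(s, t, 1)]; division by it lands on the sphere. *)
  pose N := Num.sqrt (s ^+ 2 + t ^+ 2 + 1).
  have N2 : N ^+ 2 = s ^+ 2 + t ^+ 2 + 1.
    by rewrite sqr_sqrtr// !addr_ge0 ?sqr_ge0.
  have N0 : 0 < N by rewrite sqrtr_gt0 ltr_wpDl// addr_ge0 ?sqr_ge0.
  have leN v : v ^+ 2 <= N ^+ 2 -> - N <= v <= N.
    by move=> h; rewrite -ler_norml -(@ler_pXn2r _ 2) ?nnegrE ?(ltW N0)// real_normK ?num_real.
  have quo v : v ^+ 2 <= N ^+ 2 -> -1 <= v / N <= 1.
    by move=> /leN; rewrite ler_pdivlMr// ler_pdivrMr// mulN1r mul1r.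
  exists ((r, s / N), (t / N, N^-1)) => //; split.
    rewrite /box /= !in_itv/= rr1; split; split=> //.
    - by apply: quo; rewrite N2; have := sqr_ge0 t; lra.
    - rewrite divr_ge0 ?(ltW N0)//=.
      by have /andP[_ ->]// : -1 <= t / N <= 1; apply: quo; rewrite N2; have := sqr_ge0 s; lra.
    - rewrite invr_ge0 (ltW N0)/= -[N^-1]mul1r.
      have /andP[_ ->]// : -1 <= 1 / N <= 1.
      by apply: quo; rewrite N2; have := sqr_ge0 s; have := sqr_ge0 t; lra.
  apply/ZP; split.
    rewrite /nrm /= !exprMn exprVn -mulrDl -[X in _ + X]mul1r -mulrDl -N2 divff//.
    by rewrite expf_eq0/= gt_eqF.
  rewrite /G /= (@eq_cval _ _ _ _ (fun i => RC N^-1 * (u r i + Complex s t * RC (y i ord0)))).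
    by rewrite (cval_scale _ _ hp) -/(f r (Complex s t)) frz mulr0.
  move=> i; rewrite [RHS]mulrDr; congr (_ + _).
  rewrite mulrA; congr (_ * _); apply/eqP.
  by rewrite eq_complex /= !mul0r !mul1r !subr0 !addr0 !add0r ![_ / N]mulrC !eqxx.
have K0 : (box `&` Z) !=set0.
  by have [|w ? _] := memK r1 z1 _ z10 h1; [rewrite r10 lexx|exists w].
have [w /set_mem[wbox /ZP[wn wG]] wmin] :=
  compact_EVT_min K0 cK (continuous_subspaceT c11).
have [rs0 rs1 s20 k0] : [/\ 0 <= w.1.1, w.1.1 <= r1, 0 <= w.2.1 & 0 <= w.2.2].
  move: wbox; rewrite /box/= !in_itv/= => -[[/andP[? ?] _] [/andP[? _] /andP[? _]]].
  by split.
(* A zero at infinity, [k = 0], would give [(s1 + i s2)^d p(y) = 0], hence [s1 = s2 = 0], against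
   the normalization. *)
have kn0 : w.2.2 != 0.
  apply/eqP => k00; move: wG; rewrite /G k00.
  rewrite (@eq_cval _ _ _ _ (fun i => (RC w.1.2 + Complex 0 1 * RC w.2.1) * RC (y i ord0))).
    rewrite (cval_scale _ _ hp) cval_real => /eqP.
    rewrite mulf_eq0 expf_eq0 fmorph_eq0 (gt_eqF py) orbF => /andP[_].
    rewrite eq_complex /= !mul0r !mul1r !subr0 !addr0 !add0r => /andP[/eqP e1 /eqP e2].
    by move: wn; rewrite /nrm e1 e2 k00 expr0n !addr0 => /eqP; rewrite eq_sym oner_eq0.
  by move=> i; rewrite mul0r add0r.
have {}k0 : 0 < w.2.2 by rewrite lt_neqAle eq_sym kn0.
pose z := Complex (w.1.2 / w.2.2) (w.2.1 / w.2.2).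
have z0 : 0 <= complex.Im z by rewrite /= divr_ge0// ltW.
have fz : f w.1.1 z = 0.
  have : RC w.2.2 ^+ d * f w.1.1 z = 0.
    rewrite -(cval_scale _ _ hp) -wG; apply: eq_cval => i.
    rewrite mulrDr mulrA; congr (_ + _ * _); apply/eqP.
    by rewrite eq_complex /= !mul0r !mul1r !subr0 !addr0 !add0r ![w.2.2 * _]mulrC !divfK// !eqxx.
  by move=> /eqP; rewrite mulf_eq0 expf_eq0 fmorph_eq0 (negbTE kn0) andbF => /eqP.
have nozero r v : 0 <= r -> r < w.1.1 -> 0 <= complex.Im v -> f r v != 0.
  move=> r0 rlt v0; apply/eqP => frv.
  have [|w' w'K w'r] := memK r v _ v0 frv; first by rewrite r0 (le_trans (ltW rlt)).
  by have := wmin w' (mem_set w'K); rewrite w'r leNgt rlt.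
have rs_gt0 : 0 < w.1.1.
  rewrite lt_neqAle rs0 andbT eq_sym; apply/eqP => r00.
  have /negP := cval_base hyp ya al0 z0; apply.
  rewrite -fz r00 /f; apply/eqP/eq_cval => i.
  by rewrite /u rmorph0 mul0r addr0.
have cf : continuous (fun r => sqmod (f r z)).
  apply: ccontinuous_sqmod; apply: ccontinuous_cval => i.
  apply: ccontinuousD; last exact: ccontinuous_cst.
  apply: ccontinuousD; first exact: ccontinuous_cst.
  by apply: ccontinuousM; [apply: ccontinuous_real => ?; exact: cvg_id|exact: ccontinuous_cst].
have : (peval p y * complex.Im z ^+ d) ^+ 2 <= sqmod (f w.1.1 z).
  apply: (continuous_ge_limit cf) => e e0.
  (* A parameter below the minimum by less than [e], truncated at 0 because [nozero] covers [r >= 0]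
     only. *)
  pose r := Num.max 0 (w.1.1 - e / 2).
  have r0 : 0 <= r by rewrite le_max lexx.
  have rlt : r < w.1.1 by rewrite gt_max rs_gt0/= gtrBl divr_gt0.
  exists r.
    rewrite gtr0_norm ?subr_gt0// ltrBlDr -ltrBlDl lt_max; apply/orP; right.
    by rewrite ltrD2l ltrN2; lra.
  apply: (cval_lower_bound hp py) => // v v0; exact: nozero.
rewrite fz /sqmod/= expr0n addr0 => hle.
have : (peval p y * complex.Im z ^+ d) ^+ 2 == 0 by rewrite eq_le hle sqr_ge0.
rewrite sqrf_eq0 mulf_eq0 (gt_eqF py)/= expf_eq0 => /andP[_ /eqP t0].
(* With [z] real, the zero is [i al a] plus a real point, which [cval_imag_dir] excludes. *)
have zE : z = RC (complex.Re z).
  by apply/eqP; rewrite eq_complex eqxx; exact/eqP.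
have /negP := cval_imag_dir (w.1.1 *: x + complex.Re z *: y) hyp al0; apply.
rewrite -fz; apply/eqP/eq_cval => i; rewrite /u -addrA; congr (_ + _).
by rewrite zE; move: (complex.Re z) => rz; rewrite !mxE rmorphD !rmorphM.
Qed.

(** A root with [Im z >= 0] is perturbed by [i al a]. For [al > 0], [cval_homotopy] at [r1 = 1]
    rules out zeros, so the bound of [cval_lower_bound] holds; as [al] tends to 0 it forces
    [Im z = 0]. *)
Lemma hyperbolic_hcone p a y : hyperbolic p a -> hcone p a y -> hyperbolic p y.
Proof.
move=> hyp ya; have [[d hp] pa rp] := hyp; have py := hcone_pos ya.
split=> [||x z]; [by exists d|by []|rewrite rootE line_poly_chorner].
(* Real coefficients make the roots symmetric under conjugation. *)
wlog z0 : z / 0 <= complex.Im z => [wl|h].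
  have [z0|/ltW z0] := leP 0 (complex.Im z); first exact: wl.
  move=> h; have := wl (conjc z).
  have conjIm : complex.Im (conjc z) = - complex.Im z by case: (z).
  rewrite conjIm oppr_ge0 => /(_ z0) wlz.
  apply/eqP; rewrite -oppr_eq0; apply/eqP/wlz.
  rewrite (@eq_cval _ _ _ _ (fun i => conjc (RC (x i ord0) + z * RC (y i ord0)))).
    by rewrite cval_conj (eqP h) conjc0.
  by move=> i; rewrite rmorphD rmorphM /= !oppr0.
pose f (al : R) := cval p (fun i => (Complex 0 al * RC (a i ord0) + RC 1 * RC (x i ord0)) +
                   z * RC (y i ord0)).
have f0 : f 0 = 0.
  rewrite -(eqP h); apply: eq_cval => i.
  by rewrite (_ : Complex 0 0 = 0)// mul0r add0r rmorph1 mul1r.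
have cf : continuous (fun al => sqmod (f al)).
  apply: ccontinuous_sqmod; apply: ccontinuous_cval => i.
  apply: ccontinuousD; last exact: ccontinuous_cst.
  apply: ccontinuousD; last exact: ccontinuous_cst.
  apply: ccontinuousM; last exact: ccontinuous_cst.
  by split=> t /=; [exact: cvg_cst|exact: cvg_id].
have : (peval p y * complex.Im z ^+ d) ^+ 2 <= sqmod (f 0).
  apply: (continuous_ge_limit cf) => e e0; exists (e / 2).
    by rewrite sub0r normrN gtr0_norm ?divr_gt0//; lra.
  apply: (cval_lower_bound hp py) => // v v0.
  by apply: cval_homotopy hyp ya _ _ v0; rewrite ?divr_gt0.
rewrite f0 /sqmod/= expr0n addr0 => hle.
have : (peval p y * complex.Im z ^+ d) ^+ 2 == 0 by rewrite eq_le hle sqr_ge0.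
by rewrite sqrf_eq0 mulf_eq0 (gt_eqF py)/= expf_eq0 => /andP[_ /eqP].
Qed.

(* Both cones are connected components of the same set, and meet in [w]. *)
Lemma hcone_eq p a w : hyperbolic p a -> hcone p a w -> hcone p w = hcone p a.
Proof.
move=> hypa wa; have hypw := hyperbolic_hcone hypa wa.
have aw : pos_component (peval p) a w by rewrite pos_component_hcone.
rewrite -!pos_component_hcone//; apply/seteqP; split=> v.
  exact: connected_component_trans.
by apply: connected_component_trans; exact: connected_component_sym.
Qed.

Lemma hconeZ p a y t : homogeneous p -> 0 < t -> hcone p a y -> hcone p a (t *: y).
Proof.
move=> [d hp] t0 ya s s0.
have -> : t *: y + s *: a = t *: (y + (s / t) *: a).
  by rewrite scalerDr scalerA mulrC divfK ?gt_eqF.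
by rewrite (peval_scale _ _ hp) mulr_gt0 ?exprn_gt0// ya// divr_ge0// ltW.
Qed.

(** With the base direction changed from [a] to [w], the sum is a shift of [v] along the base
    direction. *)
Lemma hconeD p a v w : hyperbolic p a -> hcone p a v -> hcone p a w ->
  hcone p a (v + w).
Proof.
move=> hyp va wa; rewrite -(hcone_eq hyp wa) in va *.
by have := hcone_shift ler01 va; rewrite scale1r.
Qed.

Lemma hcone_convex p a v w s : hyperbolic p a -> hcone p a v -> hcone p a w ->
  0 <= s -> s <= 1 -> hcone p a (s *: v + (1 - s) *: w).
Proof.
move=> hyp va wa s0 s1; have [hp _ _] := hyp.
have [->|sn0] := eqVneq s 0; first by rewrite scale0r add0r subr0 scale1r.
have [->|sn1] := eqVneq s 1; first by rewrite scale1r subrr scale0r addr0.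
apply: hconeD => //; apply: hconeZ => //; first by rewrite lt_neqAle eq_sym sn0.
by rewrite subr_gt0 lt_neqAle sn1.
Qed.

End GardingTransfer.

(** * Concavity of q_e *)

Lemma is_derive_horner (R : realType) (u : {poly R}) (t : R) :
  is_derive t 1 (horner u) (u^`().[t]).
Proof. by apply: DeriveDef; [exact: derivable_horner|rewrite -derive1E -derivE]. Qed.

Lemma is_derive_div (R : realType) (f g : R -> R) (t df dg : R) : g t != 0 ->
  is_derive t 1 f df -> is_derive t 1 g dg ->
  is_derive t 1 (fun s => f s / g s) ((df * g t - f t * dg) / g t ^+ 2).
Proof.
move=> g0 Df Dg.
have dF : derivable f t 1 by exact: ex_derive.
have dG : derivable g t 1 by exact: ex_derive.
have dV := derivableV g0 dG.
apply: DeriveDef; first exact: (derivableM dF dV).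
rewrite (deriveM dF dV) (deriveV g0 dG) !derive_val.
rewrite [LHS](_ : _ = f t * (- (g t) ^- 2 * dg) + (g t)^-1 * df)//.
by field.
Qed.

Lemma is_derive_quotient (R : realType) (u v : {poly R}) (t : R) : v.[t] != 0 ->
  is_derive t 1 (fun s => u.[s] / v.[s])
    ((u^`().[t] * v.[t] - u.[t] * v^`().[t]) / v.[t] ^+ 2).
Proof. by move=> v0; apply: is_derive_div => //; exact: is_derive_horner. Qed.

Section Homogeneous.
Context (R : realType) (n : nat).

Lemma homog_big_prod (I : Type) (s : seq I) (g : I -> mpoly n R) (k : I -> nat) :
  (forall i, g i \is ishomog1 (k i) (@mdeg n)) ->
  \prod_(i <- s) g i \is ishomog1 (\sum_(i <- s) k i)%N (@mdeg n).
Proof.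
move=> gk; elim: s => [|i s IH]; first by rewrite !big_nil; exact: dhomog1.
by rewrite !big_cons; exact: dhomogM.
Qed.

Lemma homog_mmap k (h : 'I_k -> mpoly n R) (p : mpoly k R) d :
  (forall i, h i \is ishomog1 1 (@mdeg n)) ->
  p \is ishomog1 d (@mdeg k) -> mmap (@mpolyC n R) h p \is ishomog1 d (@mdeg n).
Proof.
move=> hh /dhomogP hp; rewrite /mmap big_seq; apply: rpred_sum => m mp.
rewrite mul_mpolyC; apply: rpredZ; have <- : mdeg m = d := hp m mp.
rewrite mdegE; apply: homog_big_prod => i.
by have := dhomogMn (m i) (hh i); rewrite mul1n.
Qed.

End Homogeneous.

Section Quotient.
Context (R : realType) (n : nat).
Implicit Types (p : mpoly n R) (x y e : 'cV[R]_n).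

(** Euler's identity gives [p'_e(e) = (d + 1) p(e) > 0]; derivatives of real-rooted polynomials are
    real-rooted, by [real_rooted_comb] with [a = 0] and [b = 1]. *)
Lemma ddir_hyperbolic p e d : p \is ishomog1 d.+1 (@mdeg n) ->
  hyperbolic p e -> hyperbolic (ddir p e) e.
Proof.
move=> hp [_ pe rp]; split.
- by exists d; exact: ddir_homog.
- by rewrite (euler_identity _ hp) mulr_gt0.
- move=> x; rewrite -line_poly_deriv.
  have := real_rooted_comb (a := 0) (b := 1) (rp x).
  rewrite scale0r add0r scale1r oner_eq0 orbT; apply=> //.
  by rewrite (size_line_poly _ hp _).1 ?gt_eqF.
Qed.

(* [p(x) - s p'_e(x)], with [s] the first of the [1 + n] variables. *)
Definition augmented p e : mpoly (1 + n) R :=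
  let up := mmap (@mpolyC (1 + n) R) (fun i => mpolyX R (mnm1 (rshift 1 i))) in
  up p - mpolyX R (mnm1 (lshift n ord0)) * up (ddir p e).

Lemma peval_augmented p e (s : R) x :
  peval (augmented p e) (col_mx s%:M x) = peval p x - s * peval (ddir p e) x.
Proof.
have up q : peval (mmap (@mpolyC (1 + n) R)
    (fun i => mpolyX R (mnm1 (rshift 1 i))) q) (col_mx s%:M x) = peval q x.
  rewrite /peval mmap_rmorph; apply: eq_mmap => i /=; first exact: mevalC.
  by rewrite mevalXU col_mxEd.
rewrite /augmented /peval mevalB mevalM mevalXU -!/(peval _ _) !up.
by rewrite col_mxEu mxE eqxx mulr1n.
Qed.

Lemma augmented_hyperbolic p e d : p \is ishomog1 d.+1 (@mdeg n) ->
  hyperbolic p e -> hyperbolic (augmented p e) (col_mx 0%:M e).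
Proof.
move=> hp [_ pe rp].
have homX i : mpolyX R (mnm1 i) \is ishomog1 1 (@mdeg (1 + n)).
  by rewrite dhomogX /= mdeg1.
split.
- exists d.+1; apply: rpredB; first exact: homog_mmap.
  (* The variable [s] makes up for the degree lost in [p'_e]. *)
  apply: (@dhomogM _ _ _ 1 _ d) => //.
  by apply: homog_mmap => //; exact: ddir_homog.
- by rewrite peval_augmented mul0r subr0.
move=> w; rewrite -[w]vsubmxK; set x := dsubmx w.
have [s ->] : exists s, usubmx w = s%:M.
  by exists (usubmx w ord0 ord0); exact: mx11_scalar.
(* Motion along [(0, e)] keeps [s] fixed, so the restriction to the line is [u - s u']. *)
have -> : line_poly (augmented p e) (col_mx s%:M x) (col_mx 0%:M e) =
    1 *: line_poly p x e + (- s) *: (line_poly p x e)^`().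
  apply: horner_inj => t; rewrite line_poly_horner scale_col_mx add_col_mx.
  rewrite scale_scalar_mx mulr0 -raddfD addr0 peval_augmented.
  by rewrite scale1r hornerD hornerZ line_poly_deriv !line_poly_horner mulNr.
apply: real_rooted_comb; rewrite ?oner_eq0//.
by rewrite (size_line_poly _ hp _).1 ?gt_eqF.
Qed.

End Quotient.

Section Concavity.
Context (R : realType) (n : nat).
Implicit Types (p : mpoly n R) (x y e : 'cV[R]_n).

Lemma qfunE p e x : qfun p e x = peval p x / peval (ddir p e) x.
Proof. by rewrite /qfun dirderivE. Qed.

(** Along [e] the quotient is [u / u'], with derivative [(u'^2 - u u'') / u'^2 >= 0] by Laguerre's
    inequality. *)
Lemma qfun_homo p e x t : hyperbolic p e -> hcone (ddir p e) e x ->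
  0 <= t -> qfun p e x <= qfun p e (x + t *: e).
Proof.
move=> [_ _ rp] xC t0.
pose u := line_poly p x e; pose v := u^`().
have vpos (s : R) : 0 <= s -> 0 < v.[s].
  by move=> s0; rewrite /v line_poly_deriv line_poly_horner; exact: xC.
pose df (s : R) := (u^`().[s] * v.[s] - u.[s] * v^`().[s]) / v.[s] ^+ 2.
have dfE (s : R) : 0 <= s -> is_derive s 1 (fun r => u.[r] / v.[r]) (df s).
  by move=> s0; apply: is_derive_quotient; rewrite gt_eqF ?vpos.
have cf : {within `[0, t], continuous (fun r => u.[r] / v.[r])}.
  apply: derivable_within_continuous => s; rewrite in_itv/= => /andP[s0 _].
  by have D := dfE s s0; exact: ex_derive.
have dfE' s : s \in `]0, t[%R -> is_derive s 1 (fun r => u.[r] / v.[r]) (df s).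
  by rewrite in_itv/= => /andP[/ltW s0 _]; exact: dfE.
have [c + E] := MVT_segment t0 dfE' cf.
rewrite in_itv/= => /andP[c0 _].
have dfc : 0 <= df c.
  rewrite /df divr_ge0 ?sqr_ge0// subr_ge0 -/v -expr2; exact: (real_rooted_laguerre c (rp x)).
have : 0 <= u.[t] / v.[t] - u.[0] / v.[0] by rewrite E mulr_ge0// subr_ge0.
rewrite subr_ge0 /v /u line_poly_deriv !line_poly_horner scale0r addr0.
by rewrite !qfunE.
Qed.

Lemma qfun_concave p d e x y l : p \is ishomog1 d.+1 (@mdeg n) ->
  hyperbolic p e -> hcone (ddir p e) e x -> hcone (ddir p e) e y ->
  0 <= l -> l <= 1 ->
  l * qfun p e x + (1 - l) * qfun p e y <= qfun p e (l *: x + (1 - l) *: y).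
Proof.
move=> hp hyp xC yC l0 l1.
have hyp' := ddir_hyperbolic hp hyp.
have zC := hcone_convex hyp' xC yC l0 l1.
(* Membership of [(s, w)] means [s < q_e(w + t e)] for all [t >= 0]; monotonicity along [e] reduces
   this to [t = 0]. *)
have epi (s : R) w : hcone (ddir p e) e w -> s < qfun p e w ->
    hcone (augmented p e) (col_mx 0%:M e) (col_mx s%:M w).
  move=> wC sw t t0; rewrite scale_col_mx add_col_mx scale_scalar_mx mulr0.
  rewrite -raddfD addr0 peval_augmented subr_gt0 -ltr_pdivlMr ?wC//.
  by rewrite -qfunE; apply: lt_le_trans sw _; exact: qfun_homo.
(* Only the strict hypograph is known to lie in the cone, so both values are lowered by [eps]. *)
apply/ler_addgt0Pr => eps eps0; rewrite -lerBlDr; apply: ltW.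
have lt_sub (r : R) : r - eps < r by rewrite gtrBl.
have h := hcone_convex (augmented_hyperbolic hp hyp)
  (epi (qfun p e x - eps) _ xC _) (epi (qfun p e y - eps) _ yC _) l0 l1.
have {h}/hcone_pos := h (lt_sub _) (lt_sub _).
rewrite !scale_col_mx add_col_mx !scale_scalar_mx -raddfD peval_augmented.
rewrite subr_gt0 -ltr_pdivlMr ?(hcone_pos zC)// -qfunE.
move: (qfun p e x) (qfun p e y) (qfun p e _) => qx qy qz.
by rewrite !mulrBr addrACA -opprD -mulrDl [l + _]addrC subrK mul1r.
Qed.

End Concavity.

(** * Optimality conditions *)

Section LinearFunctional.
Context (R : realType) (n : nat).
Implicit Types (c : 'rV[R]_n) (x y v : 'cV[R]_n).

Lemma appD c x y : app c (x + y) = app c x + app c y.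
Proof. by rewrite /app mulmxDr mxE. Qed.

Lemma appZ c t x : app c (t *: x) = t * app c x.
Proof. by rewrite /app -scalemxAr mxE. Qed.

Lemma appB c x y : app c (x - y) = app c x - app c y.
Proof. by rewrite appD -scaleN1r appZ mulN1r. Qed.

(** The columns of [cokermx A] lie in the kernel of [A], and a row vector that kills them all is in
    the row space of [A]. *)
Lemma app_eq0_ker m (A : 'M[R]_(m, n)) c :
  (forall v, A *m v = 0 -> app c v = 0) -> exists y : 'rV[R]_m, c = y *m A.
Proof.
move=> h; apply/submxP; rewrite submxE; apply/eqP/matrixP => i j.
have := h (col j (cokermx A)).
have -> : A *m col j (cokermx A) = 0 by rewrite colE mulmxA mulmx_coker mul0mx.
move=> /(_ erefl) h0; rewrite (ord1 i) [RHS]mxE -h0.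
by rewrite /app 2!mxE; apply: eq_bigr => k _; rewrite [in RHS]mxE.
Qed.

Lemma open_line (S : set 'cV[R]_n) x v : open S -> S x ->
  exists2 r, 0 < r & forall t, `|t| < r -> S (x + t *: v).
Proof.
move=> oS Sx.
have cl : continuous (fun t : R => x + t *: v).
  move=> t; apply: cvgD; first exact: cvg_cst.
  by apply: cvgZ; [exact: cvg_id|exact: cvg_cst].
have : \forall t \near (0 : R), S (x + t *: v).
  apply: (cl 0 S); apply: open_nbhs_nbhs; split=> //.
  by rewrite scale0r addr0.
move=> /nbhs_ballP[r /= r0 hr]; exists r => // t tr.
by apply: hr; rewrite /ball/= sub0r normrN.
Qed.

End LinearFunctional.

(** Factoring [h = X g] gives [h'(0) = g(0)], and [g] is nonnegative at arbitrarily small positive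
    points. *)
Lemma poly_right_deriv_ge0 (R : realType) (h : {poly R}) : h.[0] = 0 ->
  (forall t, 0 < t -> t <= 1 -> 0 <= h.[t]) -> 0 <= h^`().[0].
Proof.
move=> h0 hpos; have /factor_theorem[g gE] : root h 0 by rewrite rootE h0.
have -> : h^`().[0] = g.[0].
  by rewrite gE derivM derivXsubC mulr1 hornerD hornerM hornerXsubC subrr mulr0 add0r.
apply: (continuous_ge_limit (f := horner g)) => [|e e0]; first exact: continuous_horner.
have m0 : 0 < Num.min 1 (e / 2) by rewrite lt_min ltr01 divr_gt0.
exists (Num.min 1 (e / 2)).
  by rewrite sub0r normrN gtr0_norm// gt_min; apply/orP; right; lra.
have := hpos _ m0; rewrite ge_min lexx => /(_ isT).
by rewrite gE hornerM hornerXsubC subr0 pmulr_lge0.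
Qed.

Lemma poly_right_pos (R : realType) (h : {poly R}) : h.[0] = 0 ->
  0 < h^`().[0] -> exists2 r, 0 < r & forall t, 0 < t -> t < r -> 0 < h.[t].
Proof.
move=> h0; have /factor_theorem[g gE] : root h 0 by rewrite rootE h0.
have -> : h^`().[0] = g.[0].
  by rewrite gE derivM derivXsubC mulr1 hornerD hornerM hornerXsubC subrr mulr0 add0r.
move=> g0; have : \forall t \near (0 : R), 0 < g.[t].
  have := @continuous_horner R g 0 [set r | 0 < r]; apply.
  by apply: open_nbhs_nbhs; split=> //; exact: open_gt.
move=> /nbhs_ballP[r /= r0 hr]; exists r => // t t0 tr.
rewrite gE hornerM hornerXsubC subr0 mulr_gt0//.
by apply: hr; rewrite /ball/= sub0r normrN gtr0_norm.
Qed.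

(** * The cones of [p] and of [p'_e] *)

Section Cones.
Context (R : realType) (n : nat).
Implicit Types (p : mpoly n R) (x y e v : 'cV[R]_n).

(** Degree 0 would make [p] constant. The form [d.+1] lets [p'_e] have degree [d] without truncated
    subtraction. *)
Lemma nonconstant_homog p : nonconstant p -> homogeneous p ->
  exists d, p \is ishomog1 d.+1 (@mdeg n).
Proof.
move=> nc [[|d] hp]; last by exists d.
case: (nc (mcoeff mnm0 p)); apply/mpolyP => m; rewrite mcoeffC.
have [->|m0] := eqVneq m mnm0; first by rewrite mulr1.
rewrite mulr0; apply: (dhomog_nemf_coeff hp) => /=.
by rewrite mdeg_eq0.
Qed.

Lemma deriv_open_coneE p d e : p \is ishomog1 d.+1 (@mdeg n) ->
  hyperbolic p e -> deriv_open_cone p e = hcone (ddir p e) e.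
Proof.
move=> hp hyp; rewrite /deriv_open_cone.
rewrite (_ : dirderiv p e = peval (ddir p e)); last first.
  by apply/funext => x; exact: dirderivE.
exact: pos_component_hcone (ddir_hyperbolic hp hyp).
Qed.

(** The polynomial [t |-> p (y + t e)] is nonconstant with negative roots only, so its derivative is
    positive for [t >= 0]. *)
Lemma hcone_sub_deriv p d e y : p \is ishomog1 d.+1 (@mdeg n) ->
  hyperbolic p e -> hcone p e y -> hcone (ddir p e) e y.
Proof.
move=> hp [_ pe rp] yC t t0; rewrite -line_poly_horner -line_poly_deriv.
apply: (real_rooted_pos_deriv (rp y) _ t0).2; last first.
  by rewrite (size_line_poly _ hp _).1 ?gt_eqF.
by move=> s s0; rewrite line_poly_horner; exact: yC.
Qed.

(** From [x] on, [p] increases strictly along [e], its derivative [p'_e] being positive on the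
    ray. *)
Lemma deriv_cone_shift_pos p e x t : hcone (ddir p e) e x ->
  0 <= peval p x -> 0 < t -> 0 < peval p (x + t *: e).
Proof.
move=> xC px t0; rewrite -line_poly_horner.
have dE (s : R) : is_derive s 1 (horner (line_poly p x e)) ((line_poly p x e)^`().[s]).
  exact: is_derive_horner.
have ch : {within `[0, t], continuous (horner (line_poly p x e))}.
  by apply: continuous_subspaceT; exact: continuous_horner.
have [s + E] := MVT t0 (fun s _ => dE s) ch; rewrite in_itv/= => /andP[s0 _].
rewrite -(subrK ((line_poly p x e).[0]) _.[t]) E line_poly_deriv_horner subr0.
rewrite [(line_poly p x e).[0]]line_poly_horner scale0r addr0.
by rewrite ltr_pwDl// mulr_gt0// xC// ltW.
Qed.

Lemma deriv_cone_pos p e x : hcone (ddir p e) e x ->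
  0 < peval p x -> hcone p e x.
Proof.
move=> xC px t; rewrite le_eqVlt => /predU1P[<-|t0].
  by rewrite scale0r addr0.
by apply: deriv_cone_shift_pos => //; exact: ltW.
Qed.

(** The points [x + t e] with small [t > 0] lie in the open cone and tend to [x]. *)
Lemma deriv_cone_closure p e x : hcone (ddir p e) e x ->
  0 <= peval p x -> closure (hcone p e) x.
Proof.
move=> xC px B; rewrite nbhsE => -[U [oU Ux] UB].
have [r r0 hr] := open_line e oU Ux.
exists (x + (r / 2) *: e); split.
  move=> t t0; rewrite -addrA -scalerDl.
  by apply: deriv_cone_shift_pos => //; rewrite ltr_pwDl ?divr_gt0.
by apply: UB; apply: hr; rewrite gtr0_norm ?divr_gt0//; lra.
Qed.

Lemma closure_hcone_ge0 p e x : closure (hcone p e) x -> 0 <= peval p x.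
Proof.
have cl := closed_ge0_fun (@continuous_peval R n p).
rewrite closureE; apply: (smallest_sub cl) => y /hcone_pos; exact: ltW.
Qed.

End Cones.

(** * Optimal solutions of the two problems *)

Section Optimality.
Context (R : realType) (m n : nat) (A : 'M[R]_(m, n)) (b : 'cV[R]_m)
  (c : 'rV[R]_n) (p : mpoly n R) (e : 'cV[R]_n) (d : nat).
Context (c_notin : forall y : 'rV[R]_m, c <> y *m A)
  (p_homog : p \is ishomog1 d.+1 (@mdeg n)) (p_hyp : hyperbolic p e)
  (Ae : A *m e = b).
Implicit Types x y v : 'cV[R]_n.

Let dp := ddir p e.
Let p_homogeneous : homogeneous p. Proof. by exists d.+1. Qed.
Let pe : 0 < peval p e. Proof. by case: p_hyp. Qed.
Let dp_hyp : hyperbolic dp e. Proof. exact: ddir_hyperbolic p_homog p_hyp. Qed.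
Let dp_homog : dp \is ishomog1 d (@mdeg n). Proof. exact: ddir_homog. Qed.
Let coneE : deriv_open_cone p e = hcone dp e.
Proof. exact: deriv_open_coneE p_homog p_hyp. Qed.
Let hyp_coneE : hyp_cone p e = closure (hcone p e).
Proof. by rewrite /hyp_cone pos_component_hcone. Qed.
Let open_dcone : open (hcone dp e).
Proof. by case: dp_hyp => h1 h2 _; exact: open_hcone. Qed.

Lemma log_program_convex :
  convex_program (log_domain A b c p e) (log_objective c p e).
Proof.
have appc x y l : app c (e - (l *: x + (1 - l) *: y)) =
    l * app c (e - x) + (1 - l) * app c (e - y).
  by rewrite !appB !appD !appZ; ring.
have l01 (l : {i01 R}) : 0 <= l%:num <= 1 by rewrite ge0 le1.
split=> [x y l|l x y].
  rewrite !inE /log_domain/= coneE => -[xC Ax cx] [yC Ay cy].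
  have /andP[l0 l1] := l01 l.
  split.
  - exact: hcone_convex.
  - rewrite mulmxDr -!scalemxAr Ax Ay -scalerDl.
    by rewrite addrC subrK scale1r.
  - rewrite appc.
    exact: (convR_gt0 l cx cy).
rewrite !inE /log_domain/= coneE => -[xC Ax cx] [yC Ay cy].
have /andP[l0 l1] := l01 l.
have hq := qfun_concave p_homog p_hyp xC yC l0 l1.
have hl := concave_ln l cx cy.
set z := l%:num *: x + (1 - l%:num) *: y in hq *.
have {hl} hl : l%:num * ln (app c (e - x)) + (1 - l%:num) * ln (app c (e - y))
    <= ln (app c (e - z)) by rewrite appc; exact: hl.
change (- ln (app c (e - z)) - qfun p e z <=
  l%:num * (- ln (app c (e - x)) - qfun p e x) +
  (1 - l%:num) * (- ln (app c (e - y)) - qfun p e y)).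
move: hl hq.
move: (ln (app c (e - z))) (ln (app c (e - x))) (ln (app c (e - y))) => fz fx fy.
move: (qfun p e z) (qfun p e x) (qfun p e y) (l%:num) => qz qx qy r.
by lra.
Qed.

Lemma app_ker_neq0 : ~ (forall v, A *m v = 0 -> app c v = 0).
Proof. by move=> /app_eq0_ker[y /c_notin]. Qed.

(** Around an interior point, [x + t v] and [x - t v] are feasible for every [v] in [ker A] and
    small [t], so [c] would vanish on [ker A]. *)
Lemma hcone_not_optimal x : HP_optimal A b c p e x -> ~ hcone p e x.
Proof.
move=> [[Ax _] xmin] xC; apply: app_ker_neq0 => v Av.
have [r r0 hr] := open_line v (open_hcone p_homogeneous pe) xC.
have step t : `|t| < r -> 0 <= t * app c v.
  move=> tr; have : HP_feasible A b p e (x + t *: v).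
    split; first by rewrite mulmxDr -scalemxAr Av scaler0 addr0.
    by rewrite hyp_coneE; apply: subset_closure; exact: hr.
  by move=> /xmin; rewrite appD appZ lerDl.
have h1 := step (r / 2) _; have h2 := step (- (r / 2)) _.
have r2 : `|r / 2| < r by rewrite gtr0_norm ?divr_gt0//; lra.
apply/eqP; rewrite eq_le; apply/andP; split.
  by have := h2; rewrite normrN => /(_ r2); rewrite mulNr oppr_ge0 pmulr_rle0// divr_gt0.
by have := h1 r2; rewrite pmulr_rge0// divr_gt0.
Qed.

(** The interior point [e] is feasible, and equal values would make it optimal. *)
Lemma HP_optimal_gap x : HP_optimal A b c p e x -> 0 < app c (e - x).
Proof.
move=> [[Ax xC] xmin].
have eC := hcone_dir p_homogeneous pe.
have efeas : HP_feasible A b p e e.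
  by split=> //; rewrite hyp_coneE; exact: subset_closure.
have := xmin _ efeas; rewrite -subr_ge0 -appB le_eqVlt => /predU1P[E|//].
have /hcone_not_optimal : HP_optimal A b c p e e.
  split=> // y /xmin; apply: le_trans.
  by rewrite -subr_le0 -appB -E.
by [].
Qed.

(** The tangent inequality of the concave [q_e] at a zero. Concavity gives
    [t q_e(y) <= q_e(x + t v)] for [0 < t <= 1]; multiplied by [p'_e(x + t v) > 0], this is
    [h(t) >= 0]. As [h(0) = 0], also [h'(0) >= 0], which is the claim. *)
Lemma deriv_at_zero x v y : peval p x = 0 -> hcone dp e x ->
  hcone dp e y -> y = x + v ->
  qfun p e y <= peval (ddir p v) x / peval dp x.
Proof.
move=> px xC yC yE.
have dx0 : 0 < peval dp x by exact: hcone_pos xC.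
pose u := line_poly p x v; pose w := line_poly dp x v.
pose h := u - (qfun p e y)%:P * 'X * w.
have u0 : u.[0] = 0 by rewrite line_poly_horner scale0r addr0.
have w0 : w.[0] = peval dp x by rewrite line_poly_horner scale0r addr0.
have h0 : h.[0] = 0.
  by rewrite hornerD hornerN u0 !hornerM hornerX mulr0 mul0r subr0.
have : 0 <= h^`().[0].
  apply: poly_right_deriv_ge0 => // t t0 t1.
  rewrite hornerD hornerN !hornerM hornerC hornerX !line_poly_horner.
  have zE : x + t *: v = t *: y + (1 - t) *: x.
    by rewrite yE scalerDr addrAC -scalerDl [t + _]addrC subrK scale1r.
  have zC : hcone dp e (x + t *: v).
    by rewrite zE; apply: hcone_convex => //; exact: ltW.
  have := qfun_concave p_homog p_hyp yC xC (ltW t0) t1.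
  rewrite -zE [qfun p e x]qfunE px mul0r mulr0 addr0.
  rewrite [qfun p e (_ + _)]qfunE ler_pdivlMr ?(hcone_pos zC)//.
  by rewrite subr_ge0 [t * _]mulrC.
rewrite derivB !derivM derivC derivX mul0r add0r mulr1 hornerD hornerN hornerD.
rewrite !hornerM hornerC hornerX mulr0 mul0r addr0 w0.
rewrite line_poly_deriv_horner scale0r addr0 subr_ge0.
by rewrite ler_pdivlMr.
Qed.

Lemma dir_eq0 x : peval p x = 0 -> peval (ddir p x) x = 0.
Proof. by move=> px; rewrite (euler_identity _ p_homog) px mulr0. Qed.

Lemma HP_optimal_kkt x v : HP_optimal A b c p e x -> hcone dp e x ->
  A *m v = 0 -> peval p x = 0 /\
  app c v * peval dp x = app c (e - x) * peval (ddir p v) x.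
Proof.
move=> opt xC Av; have gap := HP_optimal_gap opt.
have [[Ax xcl] xmin] := opt.
have px : peval p x = 0.
  apply/eqP; rewrite eq_le (closure_hcone_ge0 (e := e)) -?hyp_coneE// andbT leNgt.
  by apply/negP => /(deriv_cone_pos xC); exact: hcone_not_optimal.
split=> //.
have dx0 : 0 < peval dp x by exact: hcone_pos xC.
(* A short step in a direction of increase of [p] enters the cone, so it is feasible and cannot
   lower the cost. *)
have pos w : A *m w = 0 -> 0 < peval (ddir p w) x -> 0 <= app c w.
  move=> Aw dw.
  have [||r1 r10 hr1] := @poly_right_pos R (line_poly p x w).
  - by rewrite line_poly_horner scale0r addr0.
  - by rewrite line_poly_deriv_horner scale0r addr0.
  have [r2 r20 hr2] := open_line w open_dcone xC.
  pose t := Num.min r1 r2 / 2.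
  have m0 : 0 < Num.min r1 r2 by rewrite lt_min r10.
  have t0 : 0 < t by rewrite divr_gt0.
  have tm : t < Num.min r1 r2 by rewrite /t; lra.
  have [tr1 tr2] : t < r1 /\ t < r2 by move: tm; rewrite lt_min => /andP.
  have : HP_feasible A b p e (x + t *: w).
    split; first by rewrite mulmxDr -scalemxAr Aw scaler0 addr0.
    rewrite hyp_coneE; apply: subset_closure; apply: deriv_cone_pos.
      by apply: hr2; rewrite gtr0_norm.
    by rewrite -line_poly_horner hr1.
  by move=> /xmin; rewrite appD appZ lerDl pmulr_rge0.
have Aex : A *m (e - x) = 0 by rewrite mulmxBr Ae Ax subrr.
have dex : peval (ddir p (e - x)) x = peval dp x.
  by rewrite peval_ddirD -scaleN1r peval_ddirZ dir_eq0// mulr0 addr0.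
(* A direction with zero derivative is tilted towards [e]; the factor [s] makes the tilt cost
   exactly [eps]. *)
have pos0 w : A *m w = 0 -> peval (ddir p w) x = 0 -> 0 <= app c w.
  move=> Aw dw; apply/ler_addgt0Pr => eps eps0.
  pose s := eps / app c (e - x).
  have s0 : 0 < s by rewrite divr_gt0.
  have := pos (w + s *: (e - x)).
  rewrite appD appZ /s divfK ?gt_eqF//; apply.
    by rewrite mulmxDr -scalemxAr Aw Aex scaler0 addr0.
  by rewrite peval_ddirD peval_ddirZ dw add0r dex mulr_gt0.
(* The multiple of [e - x] achieves [Dp(x)[w] = 0]. Then [pos0] applies to [w] and [- w], and
   [c w = 0] is the claimed identity. *)
pose w := peval dp x *: v - peval (ddir p v) x *: (e - x).
have Aw : A *m w = 0 by rewrite mulmxBr -!scalemxAr Av Aex !scaler0 subrr.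
have dw : peval (ddir p w) x = 0.
  by rewrite peval_ddirD -scaleN1r !peval_ddirZ dex mulN1r mulrC subrr.
have w1 := pos0 w Aw dw.
have w2 : 0 <= app c (- w).
  apply: pos0; first by rewrite mulmxN Aw oppr0.
  by rewrite -scaleN1r peval_ddirZ dw mulr0.
have : app c w = 0.
  by apply/eqP; rewrite eq_le w1 andbT -oppr_ge0 -mulN1r -appZ scaleN1r.
rewrite /w [app c (_ *: _ - _)]appB !appZ => /eqP; rewrite subr_eq0 => /eqP h.
by rewrite mulrC h mulrC.
Qed.

(** With [k = c(y - x) / c(e - x)], the tangent inequality and the optimality condition give
    [q_e(y) <= k], while [ln (1 - k) <= - k] gives [ln c(e - y) <= ln c(e - x) - k]. Adding these
    suffices, since [q_e(x) = 0]. *)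
Lemma HP_optimal_log_minimizer x : HP_optimal A b c p e x -> hcone dp e x ->
  minimizers (log_domain A b c p e) (log_objective c p e) x.
Proof.
move=> opt xC; have gap := HP_optimal_gap opt.
have [[Ax xcl] xmin] := opt.
have dx0 : 0 < peval dp x by exact: hcone_pos xC.
split=> [|y [yC Ay cy]]; first by split; rewrite ?coneE.
rewrite coneE in yC.
have Ayx : A *m (y - x) = 0 by rewrite mulmxBr Ax Ay subrr.
have [px kkt] := HP_optimal_kkt opt xC Ayx.
have qy : qfun p e y <= peval (ddir p (y - x)) x / peval dp x.
  by apply: deriv_at_zero => //; rewrite addrC subrK.
have {kkt} E : peval (ddir p (y - x)) x / peval dp x = app c (y - x) / app c (e - x).
  apply/eqP; rewrite eqr_div ?(lt0r_neq0 gap) ?(lt0r_neq0 dx0)//.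
  by rewrite kkt mulrC.
have qx : qfun p e x = 0 by rewrite qfunE px mul0r.
have eyE : app c (e - y) = app c (e - x) * (1 + - (app c (y - x) / app c (e - x))).
  rewrite mulrBr mulr1 mulrCA divff ?gt_eqF// mulr1 -appB.
  by congr (app c _); rewrite opprB addrA subrK.
have pos1 : 0 < 1 + - (app c (y - x) / app c (e - x)).
  by move: cy; rewrite eyE pmulr_rgt0.
have : ln (app c (e - y)) <= ln (app c (e - x)) - app c (y - x) / app c (e - x).
  rewrite eyE lnM ?posrE// lerD2l; apply: le_ln1Dx.
  by rewrite -subr_gt0 opprK addrC.
rewrite /log_objective qx subr0; move: qy; rewrite E.
move: (ln (app c (e - y))) (ln (app c (e - x))) (qfun p e y) (_ / _) => fy fx qy k.
by lra.
Qed.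

(** Fermat's rule on the line [x + t v]: the left side is the derivative of the logarithmic term,
    the right side that of [q_e]. *)
Lemma log_minimizer_stationary x v :
  minimizers (log_domain A b c p e) (log_objective c p e) x -> A *m v = 0 ->
  app c v / app c (e - x) =
  (peval (ddir p v) x * peval dp x - peval p x * peval (ddir dp v) x) /
    peval dp x ^+ 2.
Proof.
move=> [[xC Ax cx] xmin] Av; rewrite coneE in xC.
have dx0 : 0 < peval dp x by exact: hcone_pos xC.
pose l : {poly R} := (app c (e - x))%:P - (app c v) *: 'X.
have lE t : l.[t] = app c (e - (x + t *: v)).
  by rewrite !hornerE !appB appD appZ; ring.
have l0 : l.[0] = app c (e - x) by rewrite lE scale0r addr0.
pose u := line_poly p x v; pose w := line_poly dp x v.
have w0 : w.[0] = peval dp x by rewrite line_poly_horner scale0r addr0.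
have [r1 r10 hr1] := open_line v open_dcone xC.
have [r2 r20 hr2] : exists2 r, 0 < r & forall t, `|t| < r -> 0 < l.[t].
  have : \forall t \near (0 : R), 0 < l.[t].
    have := @continuous_horner R l 0 [set r | 0 < r]; apply.
    by apply: open_nbhs_nbhs; split; [exact: open_gt|rewrite /= l0].
  move=> /nbhs_ballP[r /= r0 hr]; exists r => // t tr.
  by apply: hr; rewrite /ball/= sub0r normrN.
pose r := Num.min r1 r2; have r0 : 0 < r by rewrite lt_min r10.
have inr t : t \in `](- r), r[ -> [/\ hcone dp e (x + t *: v), 0 < l.[t] & 0 < w.[t]].
  rewrite in_itv/= -ltr_norml lt_min => /andP[t1 t2].
  by split; [exact: hr1|exact: hr2|rewrite line_poly_horner; apply: hcone_pos (hr1 _ t1)].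
pose psi (t : R) := - ln l.[t] - u.[t] / w.[t].
have psiE t : psi t = log_objective c p e (x + t *: v).
  by rewrite /psi lE !line_poly_horner /log_objective qfunE.
pose dpsi (t : R) := - (l.[t]^-1 * l^`().[t]) -
  (u^`().[t] * w.[t] - u.[t] * w^`().[t]) / w.[t] ^+ 2.
have dE t : t \in `](- r), r[ -> is_derive t 1 psi (dpsi t).
  move=> /inr[_ lt wt].
  have D1 : is_derive t 1 (@ln R \o horner l) (l.[t]^-1 * l^`().[t]).
    exact: is_derive1_comp (is_derive1_ln lt) (is_derive_horner l t).
  have D2 := is_derive_quotient u (negbT (gt_eqF wt)).
  exact: is_deriveB (is_deriveN D1) D2.
have mid : 0 \in `](- r), r[ by rewrite in_itv/= oppr_lt0 r0.
have : is_derive (0 : R) 1 psi 0.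
  apply: (@derive1_at_min _ psi (- r) r 0 _ _ mid).
  - by rewrite (le_trans _ (ltW r0))// oppr_le0 ltW.
  - by move=> t /dE D; exact: ex_derive.
  - move=> t /inr[tC lt _]; rewrite !psiE scale0r addr0; apply: xmin; split.
    + by rewrite coneE.
    + by rewrite mulmxDr -scalemxAr Av scaler0 addr0.
    + by rewrite -lE.
have D0 := dE 0 mid.
move=> D0'; have : dpsi 0 = 0.
  by rewrite -(@derive_val _ _ _ _ _ _ _ D0) (@derive_val _ _ _ _ _ _ _ D0').
rewrite /dpsi l0 w0 !line_poly_deriv_horner line_poly_horner scale0r addr0.
rewrite derivB derivC derivZ derivX sub0r hornerN hornerZ hornerC mulr1.
rewrite mulrN opprK => /eqP; rewrite subr_eq0 => /eqP <-.
by rewrite mulrC.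
Qed.

Lemma log_minimizer_HP_optimal x :
  minimizers (log_domain A b c p e) (log_objective c p e) x ->
  HP_optimal A b c p e x /\ hcone dp e x.
Proof.
move=> xm; have [[xC Ax cx] xmin] := xm; rewrite coneE in xC.
have dx0 : 0 < peval dp x by exact: hcone_pos xC.
have px : peval p x = 0.
  have Axe : A *m (x - e) = 0 by rewrite mulmxBr Ax Ae subrr.
  have := log_minimizer_stationary xm Axe.
  rewrite -opprB -scaleN1r appZ mulN1r mulNr divff ?gt_eqF//.
  rewrite !peval_ddirZ !peval_ddirD -![- x]scaleN1r !peval_ddirZ.
  rewrite (euler_identity _ p_homog) (euler_identity _ dp_homog) -/dp.
  (* The polynomial [t |-> p'_e(x + t e)] is real-rooted and positive for [t >= 0], so its
     derivative at 0 is nonnegative. *)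
  have ddx : 0 <= peval (ddir dp e) x.
    have [_ _ rdp] := dp_hyp.
    have [|+ _] := @real_rooted_pos_deriv R _ (rdp x) _ 0 (lexx _).
      by move=> t t0; rewrite line_poly_horner; exact: xC.
    by rewrite line_poly_deriv_horner scale0r addr0.
  move: (peval p x) (peval dp x) (peval (ddir dp e) x) dx0 ddx => a q g q0 g0 E.
  (* The Euler coefficients [d + 1] of [p] and [d] of [p'_e] cancel up to a single [a q]. *)
  have : a * (q + g) = 0.
    have := congr1 (fun s => s * q ^+ 2) E.
    by rewrite /= divfK ?expf_neq0 ?(lt0r_neq0 q0)// -natr1; move: d%:R => k {}E; lra.
  by move=> /eqP; rewrite mulf_eq0 (gt_eqF (ltr_wpDr g0 q0)) orbF => /eqP.
split=> //; split.
  split=> //; rewrite hyp_coneE; apply: deriv_cone_closure => //.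
  by rewrite px.
move=> y [Ay yC]; rewrite hyp_coneE in yC.
have Ayx : A *m (y - x) = 0 by rewrite mulmxBr Ax Ay subrr.
(* Since [p(x) = 0] and [Dp(x)[x] = 0], stationarity reads [c(y - x) / c(e - x) = Dp(x)[y] /
   p'_e(x)]; it remains to see that [Dp(x)[y] >= 0]. *)
have := log_minimizer_stationary xm Ayx.
rewrite px mul0r subr0 expr2 invfM mulrA mulfK ?gt_eqF// => kkt.
rewrite -subr_ge0 -appB -(pmulr_lge0 _ (_ : 0 < (app c (e - x))^-1)) ?invr_gt0//.
rewrite kkt divr_ge0 ?(ltW dx0)//.
rewrite peval_ddirD -scaleN1r peval_ddirZ dir_eq0// mulr0 addr0.
(* The linear form [Dp(x)] as a polynomial; its continuity reduces the claim from the closure to the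
   open cone. *)
pose g : mpoly n R := \sum_i peval (mderiv i p) x *: mpolyX R (mnm1 i).
have gE z : peval (ddir p z) x = peval g z.
  rewrite peval_ddir /peval /g raddf_sum; apply: eq_bigr => i _ /=.
  by rewrite mevalZ mevalXU mulrC.
rewrite gE; have cl := closed_ge0_fun (@continuous_peval R n g).
move: y yC {Ay Ayx kkt}; rewrite closureE; apply: (smallest_sub cl) => z zC /=.
rewrite -gE.
have zC' := hcone_sub_deriv p_homog p_hyp zC.
(* On the open cone [q_e] is nonnegative, and the tangent inequality bounds it by [Dp(x)[z] /
   p'_e(x)]. *)
have q0 : 0 <= qfun p e z.
  by rewrite qfunE divr_ge0// ltW//; [exact: hcone_pos zC|exact: hcone_pos zC'].
have := deriv_at_zero px xC zC' (_ : z = x + (z - x)).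
rewrite addrC subrK => /(_ erefl); rewrite peval_ddirD -scaleN1r peval_ddirZ.
rewrite dir_eq0// mulr0 addr0 => /(le_trans q0).
by rewrite pmulr_lge0 ?invr_gt0.
Qed.

End Optimality.

Theorem theorem8 (R : realType) (m n : nat)
  (A : 'M[R]_(m, n)) (b : 'cV[R]_m) (c : 'rV[R]_n)
  (p : mpoly n R) (e : 'cV[R]_n)
  (A_surj : forall y : 'cV[R]_m, exists x : 'cV[R]_n, A *m x = y)
  (b_neq0 : b <> 0)
  (c_notin : forall y : 'rV[R]_m, c <> y *m A)
  (p_nonconst : nonconstant p)
  (p_hyp : hyperbolic p e)
  (Ae : A *m e = b) :
  convex_program (log_domain A b c p e) (log_objective c p e) /\
  HP_optimal A b c p e `&` deriv_open_cone p e =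
    minimizers (log_domain A b c p e) (log_objective c p e).
Proof.
have [p_hom _ _] := p_hyp.
have [d p_homog] := nonconstant_homog p_nonconst p_hom.
split; first exact: log_program_convex p_homog p_hyp.
rewrite (deriv_open_coneE p_homog p_hyp); apply/seteqP; split=> x.
  by move=> [opt xC]; exact: HP_optimal_log_minimizer c_notin p_homog p_hyp Ae x opt xC.
exact: log_minimizer_HP_optimal p_homog p_hyp Ae x.
Qed.
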